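(* Let $a>0$, $\nu>0$ be constants, let $\mathbb{H}^2(-a^2)$ be the $2$-dimensional space form of constant negative sectional curvature $-a^2$, let $\Phi:\mathbb{R}^2\to\mathbb{H}^2(-a^2)$, $(\tau,s)\mapsto\Phi(\tau,s)$, be the ''Cartesian coordinate system'' defined in the context, with coordinate vector fields $\frac{\partial}{\partial\tau},\frac{\partial}{\partial s}$, and let $K=\{p\in\mathbb{H}^2(-a^2):\tau(p)\le0\}=\Phi((-\infty,0]\times\mathbb{R})$ be the obstacle, whose boundary is the geodesic $\gamma=\Phi(\{0\}\times\mathbb{R})$. Consider the stationary Navier-Stokes equation $$\nu\big((-\triangle)u^*-2\,\mathrm{Ric}(u^* )\big)+[\overline{\nabla}_u u]^*+dP=0,\qquad d^*u^*=0.\qquad(\mathrm{NS})$$ Then the following two assertions hold. (Assertion I) For the quadratic function $h(\tau)=\alpha_1\tau-\frac{\alpha_2}{2}\tau^2$, with any given constants $\alpha_1>0$ and $\alpha_2>0$, the parallel laminar flow $u=-h(\tau)\frac{1}{\cosh(a\tau)}\frac{\partial}{\partial s}$ does not satisfy (NS) (with any smooth pressure $P$) on any simply-connected region of the form $$\Omega_{\tau_0}=\{p\in\mathbb{H}^2(-a^2): 0<\tau(p)<\tau_0\}=\Phi((0,\tau_0)\times\mathbb{R})\subset\mathbb{H}^2(-a^2)\setminus K,$$ where $\tau_0>0$ is an arbitrary constant. (Assertion II) For any prescribed $\alpha_1>0$ and $\alpha_2>0$, there exists a unique smooth function $Y\in C^\infty([0,\infty))$ satisfying $Y(0)=0$,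 $Y'(0)=\alpha_1$, $Y''(0)=-\alpha_2$ such that the associated parallel laminar flow $u=-Y(\tau)\frac{1}{\cosh(a\tau)}\frac{\partial}{\partial s}$ solves (NS) (for some smooth pressure $P$) in the whole exterior region $\mathbb{H}^2(-a^2)\setminus K=\Phi((0,\infty)\times\mathbb{R})$. Moreover, this unique function $Y$ is real-analytic on $[0,\infty)$.
   Context: $\mathbb{H}^2(-a^2)$ is the hyperbolic plane of constant sectional curvature $-a^2$ (complete, simply connected, oriented), with Riemannian metric $g$. Cartesian coordinate system: fix a point $O\in\mathbb{H}^2(-a^2)$ and a unit-speed geodesic $c:\mathbb{R}\to\mathbb{H}^2(-a^2)$ with $c(0)=O$ (the ''$x$-axis''). Let $w\in T_O\mathbb{H}^2(-a^2)$ be the unit vector such that $\{\dot c(0),w\}$ is a positively oriented orthonormal basis, and let $\gamma:\mathbb{R}\to\mathbb{H}^2(-a^2)$ be the geodesic with $\gamma(0)=O$, $\dot\gamma(0)=w$ (the ''$y$-axis''). Let $V(s)$ be the parallel vector field along $\gamma$ with $V(0)=\dot c(0)$. Define $$\Phi(\tau,s)=\exp_{\gamma(s)}(\tau V(s)),\qquad(\tau,s)\in\mathbb{R}^2.$$ $\Phi$ is a diffeomorphism of $\mathbb{R}^2$ onto $\mathbb{H}^2(-a^2)$. For $p\in\mathbb{H}^2(-a^2)$ write $\Phi^{-1}(p)=(\tau(p),s(p))$; $\tau,s$ thus denote smooth functions on $\mathbb{H}^2(-a^2)$, and $\frac{\partial}{\partial\tau},\frac{\partial}{\partial s}$ are the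 induced coordinate vector fields, $\frac{\partial}{\partial\tau}|_{p}f=\partial_\tau(f\circ\Phi)|_{\Phi^{-1}(p)}$ and $\frac{\partial}{\partial s}|_{p}f=\partial_s(f\circ\Phi)|_{\Phi^{-1}(p)}$. In these coordinates $g=d\tau^2+\cosh^2(a\tau)\,ds^2$, and $(d\tau,ds)$ is positively oriented. For a smooth vector field $X$, $X^*=g(X,\cdot)$ is the associated $1$-form. $\overline\nabla$ is the Levi-Civita connection. $*$ is the Hodge star, with $*d\tau=\cosh(a\tau)ds$, $*(\cosh(a\tau)ds)=-d\tau$, and $*\mathrm{Vol}=1$ where $\mathrm{Vol}=\cosh(a\tau)d\tau\wedge ds$. $d^*=-*d*$ is the formal adjoint of the exterior derivative $d$ (on $1$-forms $d^*u^*=-\mathrm{div}\,u$), and $(-\triangle)=dd^*+d^*d$ is the Hodge Laplacian on $1$-forms. $\mathrm{Ric}$ is the Ricci tensor acting on $1$-forms; on $\mathbb{H}^2(-a^2)$, $\mathrm{Ric}(u^* )=-a^2u^*$. The constant $\nu>0$ is the viscosity. A vector field $u$ ''satisfies'' or ''solves'' (NS) on a region if there is a smooth pressure function $P$ on that region such that the system holds there. *)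

(* Defs.v *)
From Stdlib Require Import Reals.
From Coquelicot Require Import Coquelicot.

Open Scope R_scope.

Definition E3 : Type := (R * R * R)%type.

Definition px (v : E3) : R := fst (fst v).
Definition py (v : E3) : R := snd (fst v).
Definition pz (v : E3) : R := snd v.

Definition vadd (v w : E3) : E3 := (px v + px w, py v + py w, pz v + pz w).
Definition vscale (k : R) (v : E3) : E3 := (k * px v, k * py v, k * pz v).
Definition vzero : E3 := (0, 0, 0).

(** Lorentzian inner product; it is positive definite on the tangent planes of
    the hyperboloid, and its restriction to them is the hyperbolic metric. *)
Definition mink (v w : E3) : R := - (px v * px w) + py v * py w + pz v * pz w.

Definition det3 (u v w : E3) : R :=
  px u * (py v * pz w - pz v * py w)
  - py u * (px v * pz w - pz v * px w)
  + pz u * (px v * py w - py v * px w).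

(** The hyperboloid model of H^2(-a^2). *)
Definition hyp_plane (a : R) (p : E3) : Prop :=
  mink p p = - / (a ^ 2) /\ 0 < px p.

Definition tangent (p v : E3) : Prop := mink p v = 0.

(** The orientation of the hyperboloid induced by the outward normal p. *)
Definition pos_oriented (p v w : E3) : Prop := 0 < det3 p v w.

Definition smooth_curve (c : R -> E3) : Prop :=
  forall (n : nat) (t : R),
    ex_derive_n (fun x => px (c x)) n t /\
    ex_derive_n (fun x => py (c x)) n t /\
    ex_derive_n (fun x => pz (c x)) n t.

Definition velocity (c : R -> E3) (t : R) : E3 :=
  (Derive (fun x => px (c x)) t,
   Derive (fun x => py (c x)) t,
   Derive (fun x => pz (c x)) t).

(** Orthogonal projection onto the tangent plane at p, using <p,p> = -1/a^2. *)
Definition tangent_proj (a : R) (p v : E3) : E3 :=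
  vadd v (vscale (a ^ 2 * mink v p) p).

(** Levi-Civita covariant derivative of the field V along the curve c: the
    tangential part of the ambient derivative. *)
Definition cov_along (a : R) (c V : R -> E3) (t : R) : E3 :=
  tangent_proj a (c t) (velocity V t).

Definition geodesic (a : R) (c : R -> E3) : Prop :=
  smooth_curve c /\
  (forall t, hyp_plane a (c t)) /\
  (forall t, cov_along a c (velocity c) t = vzero).

Definition parallel_along (a : R) (c V : R -> E3) : Prop :=
  smooth_curve V /\
  (forall t, tangent (c t) (V t)) /\
  (forall t, cov_along a c V t = vzero).

(** [is_exp a p v q] reads  exp_p(v) = q. *)
Definition is_exp (a : R) (p v q : E3) : Prop :=
  exists c : R -> E3,
    geodesic a c /\ c 0 = p /\ velocity c 0 = v /\ c 1 = q.

(** A global parametrization Phi together with its inverse p |-> (tau p, s p). *)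
Record chart : Type := Chart {
  Phi : R -> R -> E3;
  tau_of : E3 -> R;
  s_of : E3 -> R
}.

Definition cartesian_coordinates
    (a : R) (O : E3) (c : R -> E3) (w : E3) (gam V : R -> E3) (X : chart)
    : Prop :=
  hyp_plane a O /\
  (geodesic a c /\ c 0 = O /\
   forall t, mink (velocity c t) (velocity c t) = 1) /\
  (tangent O w /\ mink w w = 1 /\ mink (velocity c 0) w = 0 /\
   pos_oriented O (velocity c 0) w) /\
  (geodesic a gam /\ gam 0 = O /\ velocity gam 0 = w) /\
  (parallel_along a gam V /\ V 0 = velocity c 0) /\
  (forall t y, is_exp a (gam y) (vscale t (V y)) (Phi X t y)) /\
  (forall t y, tau_of X (Phi X t y) = t /\ s_of X (Phi X t y) = y) /\
  (forall p, hyp_plane a p -> Phi X (tau_of X p) (s_of X p) = p).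

Inductive ix : Type := Itau | Is.

Definition sum2 (F : ix -> R) : R := F Itau + F Is.

Definition scalar : Type := E3 -> R.

(** Components with respect to (d/dtau, d/ds) and (dtau, ds) respectively.
    A 2-form is represented by its coefficient on dtau /\ ds. *)
Definition vfield : Type := ix -> scalar.
Definition form1 : Type := ix -> scalar.
Definition form2 : Type := scalar.

Definition pd (X : chart) (i : ix) (f : scalar) : scalar := fun p =>
  match i with
  | Itau => Derive (fun t => f (Phi X t (s_of X p))) (tau_of X p)
  | Is => Derive (fun y => f (Phi X (tau_of X p) y)) (s_of X p)
  end.

Definition ex_pd (X : chart) (i : ix) (f : scalar) (p : E3) : Prop :=
  match i with
  | Itau => ex_derive (fun t => f (Phi X t (s_of X p))) (tau_of X p)
  | Is => ex_derive (fun y => f (Phi X (tau_of X p) y)) (s_of X p)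
  end.

Fixpoint class_C (X : chart) (n : nat) (U : E3 -> Prop) (f : scalar) : Prop :=
  (forall p, U p ->
     continuity_2d_pt (fun t y => f (Phi X t y)) (tau_of X p) (s_of X p)) /\
  match n with
  | O => True
  | S m => forall i : ix,
      (forall p, U p -> ex_pd X i f p) /\ class_C X m U (pd X i f)
  end.

(** Intended for open U. *)
Definition smooth_on (X : chart) (U : E3 -> Prop) (f : scalar) : Prop :=
  forall n : nat, class_C X n U f.

Definition coord_vec (X : chart) (i : ix) (p : E3) : E3 :=
  match i with
  | Itau => velocity (fun t => Phi X t (s_of X p)) (tau_of X p)
  | Is => velocity (fun y => Phi X (tau_of X p) y) (s_of X p)
  end.

Definition met (X : chart) (i j : ix) : scalar := fun p =>
  mink (coord_vec X i p) (coord_vec X j p).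

Definition det_met (X : chart) : scalar := fun p =>
  met X Itau Itau p * met X Is Is p - met X Itau Is p * met X Is Itau p.

Definition inv_met (X : chart) (i j : ix) : scalar := fun p =>
  match i, j with
  | Itau, Itau => met X Is Is p / det_met X p
  | Is, Is => met X Itau Itau p / det_met X p
  | Itau, Is => - met X Itau Is p / det_met X p
  | Is, Itau => - met X Is Itau p / det_met X p
  end.

Definition flat (X : chart) (u : vfield) : form1 := fun i p =>
  sum2 (fun j => met X i j p * u j p).

Definition sharp (X : chart) (al : form1) : vfield := fun i p =>
  sum2 (fun j => inv_met X i j p * al j p).

(** [christoffel X k i j] is Gamma^k_{ij}: the upper index comes first. *)
Definition christoffel (X : chart) (k i j : ix) : scalar := fun p =>
  / 2 * sum2 (fun l => inv_met X k l p *
    (pd X i (met X j l) p + pd X j (met X i l) p - pd X l (met X i j) p)).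

Definition nabla (X : chart) (u v : vfield) : vfield := fun k p =>
  sum2 (fun i => u i p *
    (pd X i (v k) p + sum2 (fun j => christoffel X k i j p * v j p))).

Definition ricci (X : chart) (i j : ix) : scalar := fun p =>
  sum2 (fun k =>
    pd X k (christoffel X k i j) p - pd X j (christoffel X k i k) p
    + sum2 (fun l => christoffel X k k l p * christoffel X l i j p
                     - christoffel X k j l p * christoffel X l i k p)).

Definition ricci_form (X : chart) (al : form1) : form1 := fun i p =>
  sum2 (fun j => ricci X i j p * sharp X al j p).

Definition d0 (X : chart) (f : scalar) : form1 := fun i => pd X i f.

Definition d1 (X : chart) (al : form1) : form2 := fun p =>
  pd X Itau (al Is) p - pd X Is (al Itau) p.

(** The sign of the volume density is that of the orientation in which
    (dtau, ds) is positive. *)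
Definition vol (X : chart) : scalar := fun p => sqrt (det_met X p).

Definition eps (i j : ix) : R :=
  match i, j with
  | Itau, Is => 1
  | Is, Itau => -1
  | _, _ => 0
  end.

(** The general formula (star al)_j = sqrt(det g) al^i eps_{ij}; for
    g = dtau^2 + cosh^2(a tau) ds^2 it gives star dtau = cosh(a tau) ds and
    star (cosh(a tau) ds) = - dtau. *)
Definition star1 (X : chart) (al : form1) : form1 := fun j p =>
  sum2 (fun i => vol X p * sharp X al i p * eps i j).

Definition star2 (X : chart) (om : form2) : scalar := fun p => om p / vol X p.

Definition codiff1 (X : chart) (al : form1) : scalar := fun p =>
  - star2 X (d1 X (star1 X al)) p.

Definition codiff2 (X : chart) (om : form2) : form1 := fun i p =>
  - star1 X (d0 X (star2 X om)) i p.

Definition hodge_laplacian (X : chart) (al : form1) : form1 := fun i p =>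
  d0 X (codiff1 X al) i p + codiff2 X (d1 X al) i p.

Definition solves_NS (X : chart) (nu : R) (U : E3 -> Prop) (u : vfield)
    : Prop :=
  exists P : scalar,
    smooth_on X U P /\
    forall p, U p ->
      (forall i : ix,
         nu * (hodge_laplacian X (flat X u) i p
               - 2 * ricci_form X (flat X u) i p)
         + flat X (nabla X u u) i p + d0 X P i p = 0) /\
      codiff1 X (flat X u) p = 0.

Definition parallel_flow (a : R) (X : chart) (Y : R -> R) : vfield :=
  fun i p =>
    match i with
    | Itau => 0
    | Is => - Y (tau_of X p) * (1 / cosh (a * tau_of X p))
    end.

Definition obstacle (a : R) (X : chart) (p : E3) : Prop :=
  hyp_plane a p /\ tau_of X p <= 0.

Definition exterior_region (a : R) (X : chart) (p : E3) : Prop :=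
  hyp_plane a p /\ ~ obstacle a X p.

Definition strip (a : R) (X : chart) (tau0 : R) (p : E3) : Prop :=
  hyp_plane a p /\ 0 < tau_of X p < tau0.

(** [D k] is the k-th derivative of Y on [0, +oo), one-sided at 0; the values
    at negative arguments are irrelevant.  Such a [D] exists iff Y is
    C^infinity on [0, +oo), and it is then unique on [0, +oo). *)
Definition derivatives_on_halfline (Y : R -> R) (D : nat -> R -> R) : Prop :=
  (forall x, 0 <= x -> D 0%nat x = Y x) /\
  (forall k x, 0 <= x -> D_in (D k) (D (S k)) (fun y => 0 <= y) x).

Definition smooth_with_jet (Y : R -> R) (y0 y1 y2 : R) : Prop :=
  exists D : nat -> R -> R,
    derivatives_on_halfline Y D /\
    D 0%nat 0 = y0 /\ D 1%nat 0 = y1 /\ D 2%nat 0 = y2.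

Definition real_analytic_on_halfline (Y : R -> R) : Prop :=
  forall x0, 0 <= x0 ->
    exists (b : nat -> R) (r : R), 0 < r /\
      forall x, 0 <= x -> Rabs (x - x0) < r -> is_pseries b (x - x0) (Y x).

(* Main.v *)
(** The Lorentz-orthogonal frame (O, e, w) makes Phi explicit, and the metric
    becomes dtau^2 + cosh^2(a tau) ds^2.  For u = - Y / cosh(a tau) d/ds the
    tau-equation prescribes dP/dtau as a function of tau alone, and the
    s-equation is dP/ds = - nu L(Y) with L(Y) again a function of tau.  Hence a
    pressure exists iff L(Y) is a constant k, and k = Y''(0) when Y(0) = 0.  For
    the quadratic profile, L(Y) has a nonzero second derivative at 0.  With
    x = sinh(a tau) and y = Y cosh(a tau), the equation L(Y) = k becomes
    (1 + x^2) y_xx = 2 y + k / a^2, with homogeneous solutions 1 + x^2 and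
    x + (1 + x^2) atan x and a constant particular one, so Y is elementary. *)

Require Import Defs.
From Stdlib Require Import Reals Lra Lia Wf_nat FunctionalExtensionality.
From Coquelicot Require Import Coquelicot.

Open Scope R_scope.

(** The viscous equation is of second order, yet three values at 0 are prescribed: the constant k is
    unknown as well, and Y''(0) is the datum that identifies it. The delicate point is t = 0. The
    equations hold only for tau > 0, a competitor is differentiable only from the right at 0, and
    its values at negative arguments are arbitrary. All information at 0 is therefore obtained as a
    limit from the right. For analyticity, atan composed with sinh must be expanded at every real
    point, while the series of atan at 0 has radius 1. It is treated as a primitive of a / cosh,
    which reduces the question to sums, products, reciprocals and primitives of power series. *)

Lemma cosh_sqr (x : R) : cosh x ^ 2 = 1 + sinh x ^ 2.
Proof.
  unfold cosh, sinh.
  assert (H : exp x * exp (- x) = 1)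
    by (rewrite <- exp_plus, <- exp_0; f_equal; ring).
  nra.
Qed.

Lemma cosh_gt_0 (x : R) : 0 < cosh x.
Proof.
  unfold cosh; pose proof (exp_pos x); pose proof (exp_pos (- x)); lra.
Qed.

Lemma is_derive_continuity_pt (f : R -> R) (x l : R) :
  is_derive f x l -> continuity_pt f x.
Proof.
  intro H; apply derivable_continuous_pt; exists l.
  apply is_derive_Reals, H.
Qed.

Lemma derive_zero_const (f : R -> R) :
  (forall x, is_derive f x 0) -> forall x y, f x = f y.
Proof.
  intros H x y.
  destruct (MVT_gen f y x (fun _ => 0)) as [z [_ Hz]].
  - intros; apply H.
  - intros u _; apply (is_derive_continuity_pt f u 0), H.
  - lra.
Qed.

(** [auto_derive] leaves [Derive f x] for a function known only through an [is_derive] hypothesis;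
    this replaces it by the derivative found in the context. *)
Ltac rewrite_derive_hyps :=
  repeat match goal with
    |- context [Derive ?f ?x] => rewrite (is_derive_unique f x _ ltac:(eauto))
  end.

Ltac auto_derive_hyps :=
  auto_derive;
  [ repeat split; eexists; solve [ eauto ] | rewrite_derive_hyps ].

(* f'' = m^2 f factors as (d + m)(d - m) f = 0. *)
Lemma second_order_zero (m : R) (f g : R -> R) :
  (forall x, is_derive f x (g x)) ->
  (forall x, is_derive g x (m ^ 2 * f x)) ->
  f 0 = 0 -> g 0 = 0 -> forall x, f x = 0.
Proof.
  intros Hf Hg f0 g0 x.
  assert (H1 : forall y, g y = m * f y).
  { intro y.
    assert (E : (g y - m * f y) * exp (m * y)
                = (g 0 - m * f 0) * exp (m * 0)).
    { apply (derive_zero_const (fun z => (g z - m * f z) * exp (m * z))).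
      intro z; auto_derive_hyps; ring. }
    rewrite f0, g0 in E; pose proof (exp_pos (m * y)); nra. }
  assert (E : f x * exp (- m * x) = f 0 * exp (- m * 0)).
  { apply (derive_zero_const (fun z => f z * exp (- m * z))).
    intro z; auto_derive_hyps; rewrite H1; ring. }
  rewrite f0 in E; pose proof (exp_pos (- m * x)); nra.
Qed.

(** * Geodesics of the hyperboloid *)

Definition curve_derive (c : R -> E3) (t : R) (v : E3) : Prop :=
  is_derive (fun x => px (c x)) t (px v) /\
  is_derive (fun x => py (c x)) t (py v) /\
  is_derive (fun x => pz (c x)) t (pz v).

Lemma smooth_curve_velocity (c : R -> E3) (t : R) :
  smooth_curve c -> curve_derive c t (velocity c t).
Proof.
  intros H; destruct (H 1%nat t) as (H1 & H2 & H3).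
  repeat split; apply Derive_correct; assumption.
Qed.

Lemma smooth_curve_acceleration (c : R -> E3) (t : R) :
  smooth_curve c -> curve_derive (velocity c) t (velocity (velocity c) t).
Proof.
  intros H; destruct (H 2%nat t) as (H1 & H2 & H3).
  repeat split; apply Derive_correct; assumption.
Qed.

Lemma mink_derive (c d : R -> E3) (t : R) (v w : E3) :
  curve_derive c t v -> curve_derive d t w ->
  is_derive (fun x => mink (c x) (d x)) t (mink v (d t) + mink (c t) w).
Proof.
  (* The product rule is proved for six abstract functions, which [auto_derive] treats as atoms, and
     is then matched with the coordinates by conversion. *)
  assert (G : forall (f1 f2 f3 g1 g2 g3 : R -> R) a1 a2 a3 b1 b2 b3,
    is_derive f1 t a1 -> is_derive f2 t a2 -> is_derive f3 t a3 ->
    is_derive g1 t b1 -> is_derive g2 t b2 -> is_derive g3 t b3 ->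
    is_derive (fun x => - (f1 x * g1 x) + f2 x * g2 x + f3 x * g3 x) t
      (- (a1 * g1 t) + a2 * g2 t + a3 * g3 t
       + (- (f1 t * b1) + f2 t * b2 + f3 t * b3)))
    by (intros; auto_derive_hyps; ring).
  intros (c1 & c2 & c3) (d1 & d2 & d3).
  exact (G _ _ _ _ _ _ _ _ _ _ _ _ c1 c2 c3 d1 d2 d3).
Qed.

Lemma mink_sym (v w : E3) : mink v w = mink w v.
Proof. unfold mink; ring. Qed.

Lemma E3_eq (v w : E3) : px v = px w -> py v = py w -> pz v = pz w -> v = w.
Proof.
  destruct v as [[a b] c], w as [[d e] f]; unfold px, py, pz; cbn.
  intros; subst; reflexivity.
Qed.

Lemma mink_scale_l (k : R) (v w : E3) : mink (vscale k v) w = k * mink v w.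
Proof. unfold mink, vscale, px, py, pz; cbn; ring. Qed.

(** A vanishing covariant derivative leaves only the normal part of the ambient derivative, and the
    normal line at p is spanned by p itself. *)
Lemma tangent_proj_zero (a : R) (p v : E3) :
  tangent_proj a p v = vzero -> v = vscale (- (a ^ 2 * mink v p)) p.
Proof.
  intro H.
  apply E3_eq;
    [ apply (f_equal px) in H | apply (f_equal py) in H
    | apply (f_equal pz) in H ];
    unfold tangent_proj, vadd, vscale, vzero in *;
    unfold px, py, pz in *; cbn in *; lra.
Qed.

Lemma hyp_plane_velocity (a : R) (c : R -> E3) (t : R) :
  smooth_curve c -> (forall t, hyp_plane a (c t)) -> mink (c t) (velocity c t) = 0.
Proof.
  intros Hs Hh.
  pose proof (mink_derive c c t _ _ (smooth_curve_velocity c t Hs)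
                (smooth_curve_velocity c t Hs)) as D.
  assert (D0 : is_derive (fun x => mink (c x) (c x)) t 0).
  { apply is_derive_ext with (fun _ => - / (a ^ 2)).
    - intro x; symmetry; apply Hh.
    - apply (is_derive_const (V := R_NormedModule)). }
  pose proof (is_derive_unique _ _ _ D) as E.
  rewrite (is_derive_unique _ _ _ D0) in E.
  rewrite (mink_sym (velocity c t)) in E; lra.
Qed.

(** Differentiating <c, c'> = 0 gives <c'', c> = - <c', c'>, which determines the normal
    coefficient. The speed is constant because c'' is a multiple of c, hence orthogonal to c'. The
    geodesic equation thus becomes linear with constant coefficients. *)
Lemma geodesic_acceleration (a : R) (c : R -> E3) (t : R) :
  geodesic a c ->
  velocity (velocity c) t
  = vscale (a ^ 2 * mink (velocity c 0) (velocity c 0)) (c t).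
Proof.
  intros (Hs & Hh & Hg).
  assert (Hv : forall t, mink (c t) (velocity c t) = 0)
    by (intro; apply (hyp_plane_velocity a); auto).
  assert (Ha : forall t, velocity (velocity c) t
             = vscale (- (a ^ 2 * mink (velocity (velocity c) t) (c t))) (c t))
    by (intro; apply tangent_proj_zero, Hg).
  assert (Hca : forall t, mink (velocity (velocity c) t) (c t)
                          = - mink (velocity c t) (velocity c t)).
  { intro x.
    pose proof (mink_derive c (velocity c) x _ _
      (smooth_curve_velocity c x Hs) (smooth_curve_acceleration c x Hs)) as D.
    assert (D0 : is_derive (fun x => mink (c x) (velocity c x)) x 0).
    { apply is_derive_ext with (fun _ => 0).
      - intro; symmetry; apply Hv.
      - apply (is_derive_const (V := R_NormedModule)). }
    pose proof (is_derive_unique _ _ _ D) as E.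
    rewrite (is_derive_unique _ _ _ D0) in E.
    rewrite (mink_sym (c x)) in E; lra. }
  assert (Hk : mink (velocity c t) (velocity c t)
               = mink (velocity c 0) (velocity c 0)).
  { apply (derive_zero_const (fun x => mink (velocity c x) (velocity c x))).
    intro x.
    pose proof (mink_derive _ _ x _ _
      (smooth_curve_acceleration c x Hs) (smooth_curve_acceleration c x Hs)) as D.
    rewrite (mink_sym (velocity c x)), Ha, mink_scale_l, Hv in D.
    replace 0 with
      (- (a ^ 2 * mink (velocity (velocity c) x) (c x)) * 0 +
       - (a ^ 2 * mink (velocity (velocity c) x) (c x)) * 0) by ring.
    exact D. }
  rewrite Ha, Hca, Hk; f_equal; ring.
Qed.

(** Writing the initial velocity as k v with v a unit vector avoids any division by the speed, so k
    = 0 and k < 0 are covered. *)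
Lemma geodesic_formula (a k : R) (c : R -> E3) (v : E3) (x : R) :
  0 < a -> geodesic a c -> velocity c 0 = vscale k v -> mink v v = 1 ->
  c x = vadd (vscale (cosh (a * k * x)) (c 0))
             (vscale (sinh (a * k * x) / a) v).
Proof.
  intros ha Hc Hv0 Hv.
  assert (Hs : smooth_curve c) by apply Hc.
  assert (Hacc : forall t, velocity (velocity c) t = vscale ((a * k) ^ 2) (c t)).
  { intro t; rewrite (geodesic_acceleration a c t Hc), Hv0.
    rewrite mink_scale_l, mink_sym, mink_scale_l, Hv; f_equal; ring. }
  (* One coordinate at a time: the difference to the explicit solution satisfies f'' = (a k)^2 f
     with zero initial data. *)
  assert (Main : forall f g : R -> R, forall v0,
    (forall t, is_derive f t (g t)) ->
    (forall t, is_derive g t ((a * k) ^ 2 * f t)) -> g 0 = k * v0 ->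
    f x = cosh (a * k * x) * f 0 + sinh (a * k * x) / a * v0).
  { intros f g v0 Hf Hg Hg0.
    apply Rminus_diag_uniq.
    apply (second_order_zero (a * k)
      (fun x => f x - (cosh (a * k * x) * f 0 + sinh (a * k * x) / a * v0))
      (fun x => g x - (a * k * (sinh (a * k * x) * f 0)
                       + k * cosh (a * k * x) * v0))).
    - intro t; auto_derive_hyps; field; lra.
    - intro t; auto_derive_hyps; field; lra.
    - rewrite Rmult_0_r, cosh_0, sinh_0; field; lra.
    - rewrite Rmult_0_r, cosh_0, sinh_0, Hg0; ring. }
  assert (H0 := fun t => smooth_curve_velocity c t Hs).
  assert (H1 := fun t => smooth_curve_acceleration c t Hs).
  setoid_rewrite Hacc in H1.
  apply E3_eq; cbn.
  - apply (Main (fun x => px (c x)) (fun x => px (velocity c x)));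
      [ apply H0 | apply H1 | rewrite Hv0; reflexivity ].
  - apply (Main (fun x => py (c x)) (fun x => py (velocity c x)));
      [ apply H0 | apply H1 | rewrite Hv0; reflexivity ].
  - apply (Main (fun x => pz (c x)) (fun x => pz (velocity c x)));
      [ apply H0 | apply H1 | rewrite Hv0; reflexivity ].
Qed.

(** V' is normal with coefficient a^2 <V, gam'>. This product is constant, since V' and gam'' are
    both multiples of gam, and it vanishes at 0; hence the ambient derivative of V is zero. *)
Lemma parallel_orthogonal_constant (a : R) (gam V : R -> E3) (t : R) :
  geodesic a gam -> parallel_along a gam V ->
  mink (V 0) (velocity gam 0) = 0 -> V t = V 0.
Proof.
  intros Hg (HVs & HVt & HVp) H0.
  assert (Hs : smooth_curve gam) by apply Hg.
  assert (Hv : forall t, mink (gam t) (velocity gam t) = 0)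
    by (intro; apply (hyp_plane_velocity a); [ exact Hs | apply Hg ]).
  assert (HV' : forall t, velocity V t
             = vscale (- (a ^ 2 * mink (velocity V t) (gam t))) (gam t))
    by (intro; apply tangent_proj_zero, HVp).
  assert (E : forall t, mink (velocity V t) (gam t)
                        = - mink (V t) (velocity gam t)).
  { intro x.
    pose proof (mink_derive gam V x _ _
      (smooth_curve_velocity gam x Hs) (smooth_curve_velocity V x HVs)) as D.
    assert (D0 : is_derive (fun x => mink (gam x) (V x)) x 0).
    { apply is_derive_ext with (fun _ => 0).
      - intro; symmetry; apply HVt.
      - apply (is_derive_const (V := R_NormedModule)). }
    pose proof (is_derive_unique _ _ _ D) as E.
    rewrite (is_derive_unique _ _ _ D0) in E.
    rewrite (mink_sym (velocity V x)), (mink_sym (V x)); lra. }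
  assert (K : forall t, mink (V t) (velocity gam t) = 0).
  { intro x; rewrite <- H0.
    apply (derive_zero_const (fun x => mink (V x) (velocity gam x))).
    intro y.
    pose proof (mink_derive _ _ y _ _
      (smooth_curve_velocity V y HVs) (smooth_curve_acceleration gam y Hs)) as D.
    rewrite HV', mink_scale_l, Hv, (geodesic_acceleration a gam y Hg),
      (mink_sym (V y)), mink_scale_l, (HVt y) in D.
    match type of D with is_derive _ _ ?l => replace 0 with l by ring end.
    exact D. }
  assert (Z : forall t, velocity V t = vzero).
  { intro x; rewrite HV', E, K; apply E3_eq;
      unfold vscale, vzero, px, py, pz; cbn; ring. }
  assert (D := fun t => smooth_curve_velocity V t HVs).
  setoid_rewrite Z in D.
  apply E3_eq.
  - apply (derive_zero_const (fun x => px (V x))); apply D.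
  - apply (derive_zero_const (fun x => py (V x))); apply D.
  - apply (derive_zero_const (fun x => pz (V x))); apply D.
Qed.

(* What the rest of the argument retains of the Cartesian coordinates:
   Phi is explicit in terms of the Lorentz-orthogonal frame (O, e, w). *)
Record cartesian_frame (a : R) (X : chart) (O e w : E3) : Prop := {
  frame_OO : mink O O = - / (a ^ 2);
  frame_ee : mink e e = 1;
  frame_ww : mink w w = 1;
  frame_Oe : mink O e = 0;
  frame_Ow : mink O w = 0;
  frame_ew : mink e w = 0;
  frame_Phi : forall t y,
    Phi X t y = vadd (vscale (cosh (a * t))
                        (vadd (vscale (cosh (a * y)) O)
                              (vscale (sinh (a * y) / a) w)))
                     (vscale (sinh (a * t) / a) e);
  frame_hyp : forall t y, hyp_plane a (Phi X t y);
  frame_tau : forall t y, tau_of X (Phi X t y) = t;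
  frame_s : forall t y, s_of X (Phi X t y) = y
}.

Lemma cartesian_coordinates_frame (a : R) (ha : 0 < a) (O : E3) (c : R -> E3)
  (w : E3) (gam V : R -> E3) (X : chart) :
  cartesian_coordinates a O c w gam V X ->
  cartesian_frame a X O (velocity c 0) w.
Proof.
  intros (HO & (Hc & Hc0 & Hc1) & (Hw & Hww & Hew & _) & (Hg & Hg0 & Hgw)
          & (HV & HV0) & HPhi & Hinv & _).
  assert (Hgam : forall y, gam y = vadd (vscale (cosh (a * y)) O)
                                       (vscale (sinh (a * y) / a) w)).
  { intro y; rewrite (geodesic_formula a 1 gam w y ha Hg).
    - rewrite Hg0, Rmult_1_r; reflexivity.
    - rewrite Hgw; apply E3_eq; unfold vscale, px, py, pz; cbn; ring.
    - exact Hww. }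
  assert (HVc : forall y, V y = velocity c 0).
  { intro y; rewrite <- HV0; apply (parallel_orthogonal_constant a gam); auto.
    rewrite HV0, Hgw; exact Hew. }
  constructor; auto.
  - apply HO.
  - rewrite <- Hc0; apply (hyp_plane_velocity a); apply Hc.
  - intros t y.
    (* The exponential map is read off at time 1, so the coordinate t enters as the signed speed of
       the geodesic. *)
    destruct (HPhi t y) as (d & Hd & Hd0 & Hdv & Hd1).
    rewrite <- Hd1, (geodesic_formula a t d (velocity c 0) 1 ha Hd).
    + rewrite Hd0, Hgam, Rmult_1_r; reflexivity.
    + rewrite Hdv, HVc; reflexivity.
    + apply Hc1.
  - intros t y.
    destruct (HPhi t y) as (d & Hd & Hd0 & Hdv & Hd1).
    rewrite <- Hd1; apply Hd.
  - intros; apply Hinv.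
  - intros; apply Hinv.
Qed.

(** * The equations in Cartesian coordinates *)

Lemma mink_frame (O e w : E3) (x1 x2 x3 y1 y2 y3 : R) :
  mink (vadd (vadd (vscale x1 O) (vscale x2 w)) (vscale x3 e))
       (vadd (vadd (vscale y1 O) (vscale y2 w)) (vscale y3 e))
  = x1 * y1 * mink O O + x2 * y2 * mink w w + x3 * y3 * mink e e
    + (x1 * y2 + x2 * y1) * mink O w + (x1 * y3 + x3 * y1) * mink O e
    + (x2 * y3 + x3 * y2) * mink e w.
Proof. unfold mink, vadd, vscale, px, py, pz; cbn; ring. Qed.

(** The geometric quantities below are equated with radial ones as functions on all of [E3], so that
    the equalities can be rewritten under [pd]. This holds off the hyperboloid too, because [pd] and
    [coord_vec] see p only through its two coordinates. *)
Definition radial (X : chart) (f : R -> R) : scalar := fun p => f (tau_of X p).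

Definition metric_coef (a : R) (i j : ix) (t : R) : R :=
  match i, j with
  | Itau, Itau => 1
  | Is, Is => cosh (a * t) ^ 2
  | _, _ => 0
  end.

Definition christoffel_coef (a : R) (k i j : ix) (t : R) : R :=
  match k, i, j with
  | Itau, Is, Is => - (a * cosh (a * t) * sinh (a * t))
  | Is, Itau, Is | Is, Is, Itau => a * sinh (a * t) / cosh (a * t)
  | _, _, _ => 0
  end.

(* The s-component of (-Laplace - 2 Ric) u^* for u = - (Y / cosh) d/ds. *)
Definition shear (a : R) (Y : R -> R) (t : R) : R :=
  cosh (a * t)
    * Derive (fun x => Derive (fun z => Y z * cosh (a * z)) x / cosh (a * x)) t
  - 2 * a ^ 2 * (Y t * cosh (a * t)).

Section CartesianFrame.

Variables (a : R) (ha : 0 < a) (X : chart) (O e w : E3).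
Hypothesis HX : cartesian_frame a X O e w.

Lemma coord_vec_tau (p : E3) :
  coord_vec X Itau p =
  vadd (vadd (vscale (a * sinh (a * tau_of X p) * cosh (a * s_of X p)) O)
             (vscale (sinh (a * tau_of X p) * sinh (a * s_of X p)) w))
       (vscale (cosh (a * tau_of X p)) e).
Proof.
  apply E3_eq; cbn; apply is_derive_unique;
    (eapply is_derive_ext;
     [ intro x; rewrite (frame_Phi _ _ _ _ _ HX); reflexivity | ]);
    unfold vadd, vscale; unfold px, py, pz; cbn;
    auto_derive; auto; field; lra.
Qed.

(** The zero multiple of e keeps the shape expected by [mink_frame]. *)
Lemma coord_vec_s (p : E3) :
  coord_vec X Is p =
  vadd (vadd (vscale (a * cosh (a * tau_of X p) * sinh (a * s_of X p)) O)
             (vscale (cosh (a * tau_of X p) * cosh (a * s_of X p)) w))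
       (vscale 0 e).
Proof.
  apply E3_eq; cbn; apply is_derive_unique;
    (eapply is_derive_ext;
     [ intro x; rewrite (frame_Phi _ _ _ _ _ HX); reflexivity | ]);
    unfold vadd, vscale; unfold px, py, pz; cbn;
    auto_derive; auto; field; lra.
Qed.

Lemma met_radial (i j : ix) : met X i j = radial X (metric_coef a i j).
Proof.
  apply functional_extensionality; intro p; unfold met, radial.
  pose proof (cosh_sqr (a * tau_of X p)) as Ht.
  pose proof (cosh_sqr (a * s_of X p)) as Hs.
  destruct i, j; cbn [metric_coef];
    rewrite ?coord_vec_tau, ?coord_vec_s, mink_frame,
      (frame_OO _ _ _ _ _ HX), (frame_ee _ _ _ _ _ HX),
      (frame_ww _ _ _ _ _ HX), (frame_Oe _ _ _ _ _ HX),
      (frame_Ow _ _ _ _ _ HX), (frame_ew _ _ _ _ _ HX).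
  - transitivity (cosh (a * tau_of X p) ^ 2 + sinh (a * tau_of X p) ^ 2
      * (sinh (a * s_of X p) ^ 2 - cosh (a * s_of X p) ^ 2)); [ field; lra | ].
    rewrite Ht, Hs; ring.
  - field; lra.
  - field; lra.
  - transitivity (cosh (a * tau_of X p) ^ 2
      * (cosh (a * s_of X p) ^ 2 - sinh (a * s_of X p) ^ 2)); [ field; lra | ].
    rewrite Hs; ring.
Qed.

Lemma pd_tau_radial (f : R -> R) : pd X Itau (radial X f) = radial X (Derive f).
Proof.
  apply functional_extensionality; intro p; unfold pd, radial.
  apply Derive_ext; intro t; rewrite (frame_tau _ _ _ _ _ HX); reflexivity.
Qed.

Lemma pd_s_radial (f : R -> R) : pd X Is (radial X f) = radial X (fun _ => 0).
Proof.
  apply functional_extensionality; intro p; unfold pd, radial.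
  erewrite Derive_ext;
    [ | intro t; rewrite (frame_tau _ _ _ _ _ HX); reflexivity ].
  apply Derive_const.
Qed.

Lemma det_met_radial : det_met X = radial X (fun t => cosh (a * t) ^ 2).
Proof.
  apply functional_extensionality; intro p; unfold det_met.
  rewrite !met_radial; unfold radial; cbn; ring.
Qed.

(** For a diagonal metric, g_ij / g_ii^2 is 1 / g_ii on the diagonal and 0 off it: one formula for
    the four cases. *)
Lemma inv_met_radial (i j : ix) :
  inv_met X i j = radial X (fun t => metric_coef a i j t / metric_coef a i i t ^ 2).
Proof.
  apply functional_extensionality; intro p.
  pose proof (cosh_gt_0 (a * tau_of X p)).
  destruct i, j; cbn; rewrite !met_radial, det_met_radial;
    unfold radial; cbn; field; lra.
Qed.

Lemma vol_radial : vol X = radial X (fun t => cosh (a * t)).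
Proof.
  apply functional_extensionality; intro p; unfold vol.
  rewrite det_met_radial; unfold radial.
  apply sqrt_pow2, Rlt_le, cosh_gt_0.
Qed.

Lemma pd_met (k i j : ix) :
  pd X k (met X i j) = radial X (fun t =>
    match k, i, j with
    | Itau, Is, Is => 2 * a * cosh (a * t) * sinh (a * t)
    | _, _, _ => 0
    end).
Proof.
  rewrite met_radial.
  destruct k.
  - rewrite pd_tau_radial; apply functional_extensionality; intro p.
    unfold radial; destruct i, j; unfold metric_coef; try apply Derive_const.
    apply is_derive_unique; auto_derive; auto; ring.
  - rewrite pd_s_radial; destruct i, j; reflexivity.
Qed.

Lemma christoffel_radial (k i j : ix) :
  christoffel X k i j = radial X (christoffel_coef a k i j).
Proof.
  apply functional_extensionality; intro p.
  pose proof (cosh_gt_0 (a * tau_of X p)).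
  unfold christoffel, sum2; rewrite !inv_met_radial, !pd_met.
  destruct k, i, j; unfold radial; cbn; field; lra.
Qed.

Lemma Derive_christoffel_s (t : R) :
  Derive (fun t => a * sinh (a * t) / cosh (a * t)) t = a ^ 2 / cosh (a * t) ^ 2.
Proof.
  pose proof (cosh_gt_0 (a * t)); pose proof (cosh_sqr (a * t)) as E.
  apply is_derive_unique; auto_derive.
  { apply Rgt_not_eq; assumption. }
  transitivity (a ^ 2 * (cosh (a * t) ^ 2 - sinh (a * t) ^ 2) / cosh (a * t) ^ 2).
  - field; lra.
  - rewrite E; f_equal; ring.
Qed.

Lemma Derive_christoffel_tau (t : R) :
  Derive (fun t => - (a * cosh (a * t) * sinh (a * t))) t
  = - a ^ 2 * (cosh (a * t) ^ 2 + sinh (a * t) ^ 2).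
Proof. apply is_derive_unique; auto_derive; auto; ring. Qed.

Lemma pd_christoffel (l k i j : ix) :
  pd X l (christoffel X k i j) = radial X (fun t =>
    match l, k, i, j with
    | Itau, Itau, Is, Is => - a ^ 2 * (cosh (a * t) ^ 2 + sinh (a * t) ^ 2)
    | Itau, Is, Itau, Is | Itau, Is, Is, Itau => a ^ 2 / cosh (a * t) ^ 2
    | _, _, _, _ => 0
    end).
Proof.
  rewrite christoffel_radial.
  destruct l; [ rewrite pd_tau_radial | rewrite pd_s_radial ];
    apply functional_extensionality; intro p; unfold radial;
    destruct k, i, j; unfold christoffel_coef; try apply Derive_const;
    first [ apply Derive_christoffel_s | apply Derive_christoffel_tau
          | reflexivity ].
Qed.

Lemma ricci_radial (i j : ix) :
  ricci X i j = radial X (fun t => - a ^ 2 * metric_coef a i j t).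
Proof.
  apply functional_extensionality; intro p.
  pose proof (cosh_gt_0 (a * tau_of X p)).
  pose proof (cosh_sqr (a * tau_of X p)) as E.
  unfold ricci, sum2; rewrite !pd_christoffel, !christoffel_radial.
  destruct i, j; unfold radial; cbn [christoffel_coef metric_coef].
  - transitivity (- a ^ 2 * (1 + sinh (a * tau_of X p) ^ 2)
                  / cosh (a * tau_of X p) ^ 2); [ field; lra | ].
    rewrite <- E; field; lra.
  - field; lra.
  - field; lra.
  - field; lra.
Qed.

Lemma flat_parallel_flow (Y : R -> R) (i : ix) :
  flat X (parallel_flow a X Y) i
  = radial X (fun t => match i with Itau => 0 | Is => - Y t * cosh (a * t) end).
Proof.
  apply functional_extensionality; intro p; unfold flat, sum2, parallel_flow.
  rewrite !met_radial; unfold radial.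
  pose proof (cosh_gt_0 (a * tau_of X p)).
  destruct i; cbn [metric_coef]; field; lra.
Qed.

Lemma star1_radial (f g : R -> R) (al : Defs.form1) (j : ix) :
  al Itau = radial X f -> al Is = radial X g ->
  star1 X al j = radial X (fun t => match j with
                                    | Itau => - g t / cosh (a * t)
                                    | Is => cosh (a * t) * f t
                                    end).
Proof.
  intros Hf Hg.
  apply functional_extensionality; intro p; unfold star1, sharp, sum2.
  rewrite !inv_met_radial, vol_radial, Hf, Hg; unfold radial.
  pose proof (cosh_gt_0 (a * tau_of X p)).
  destruct j; cbn [metric_coef eps]; field; lra.
Qed.

(** The flow has only an s-component, and that component does not depend on s. *)
Lemma codiff1_parallel_flow (Y : R -> R) :
  codiff1 X (flat X (parallel_flow a X Y)) = radial X (fun _ => 0).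
Proof.
  apply functional_extensionality; intro p; unfold codiff1, star2, Defs.d1.
  rewrite !(star1_radial _ _ _ _ (flat_parallel_flow Y Itau)
    (flat_parallel_flow Y Is)), vol_radial, pd_tau_radial, pd_s_radial.
  unfold radial.
  rewrite (Derive_ext _ (fun _ => 0)), Derive_const by (intro; ring).
  pose proof (cosh_gt_0 (a * tau_of X p)); field; lra.
Qed.

(** Y is an arbitrary function here: [Derive] is total, and [Derive_ext] and [Derive_opp] hold
    unconditionally. The equations can thus be rewritten before anything is known about the
    regularity of a competitor. *)
Lemma codiff2_d1_parallel_flow (Y : R -> R) (i : ix) :
  codiff2 X (Defs.d1 X (flat X (parallel_flow a X Y))) i
  = radial X (fun t => match i with
      | Itau => 0
      | Is => cosh (a * t) * Derive (fun x =>
                Derive (fun z => Y z * cosh (a * z)) x / cosh (a * x)) t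
      end).
Proof.
  assert (E : star2 X (Defs.d1 X (flat X (parallel_flow a X Y)))
    = radial X (fun x =>
        - (Derive (fun z => Y z * cosh (a * z)) x / cosh (a * x)))).
  { apply functional_extensionality; intro p; unfold star2, Defs.d1.
    rewrite !flat_parallel_flow, pd_tau_radial, pd_s_radial, vol_radial.
    unfold radial.
    rewrite (Derive_ext _ (fun z => - (Y z * cosh (a * z)))), Derive_opp
      by (intro; ring).
    pose proof (cosh_gt_0 (a * tau_of X p)); field; lra. }
  unfold codiff2; rewrite E; apply functional_extensionality; intro p.
  rewrite (star1_radial _ _ _ i (pd_tau_radial _) (pd_s_radial _)).
  unfold radial; destruct i.
  - pose proof (cosh_gt_0 (a * tau_of X p)); field; lra.
  - rewrite Derive_opp; ring.
Qed.

Lemma hodge_laplacian_parallel_flow (Y : R -> R) (i : ix) :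
  hodge_laplacian X (flat X (parallel_flow a X Y)) i
  = codiff2 X (Defs.d1 X (flat X (parallel_flow a X Y))) i.
Proof.
  apply functional_extensionality; intro p; unfold hodge_laplacian, d0.
  rewrite codiff1_parallel_flow.
  destruct i; rewrite ?pd_tau_radial, ?pd_s_radial; unfold radial;
    rewrite ?Derive_const; ring.
Qed.

Lemma ricci_form_parallel_flow (Y : R -> R) (i : ix) :
  ricci_form X (flat X (parallel_flow a X Y)) i
  = radial X (fun t => match i with
                       | Itau => 0
                       | Is => a ^ 2 * (Y t * cosh (a * t))
                       end).
Proof.
  apply functional_extensionality; intro p; unfold ricci_form, sharp, sum2.
  rewrite !ricci_radial, !flat_parallel_flow, !inv_met_radial; unfold radial.
  pose proof (cosh_gt_0 (a * tau_of X p)).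
  destruct i; cbn [metric_coef]; field; lra.
Qed.

(** Only the symbol with indices [Itau Is Is] survives. It yields a centrifugal term in the
    tau-direction that depends on tau alone, so a pressure can absorb it. *)
Lemma convection_parallel_flow (Y : R -> R) (i : ix) :
  flat X (nabla X (parallel_flow a X Y) (parallel_flow a X Y)) i
  = radial X (fun t => match i with
      | Itau => - (Y t ^ 2 * (a * sinh (a * t) / cosh (a * t)))
      | Is => 0
      end).
Proof.
  assert (E : parallel_flow a X Y Is
              = radial X (fun t => - Y t * (1 / cosh (a * t)))) by reflexivity.
  assert (E0 : parallel_flow a X Y Itau = radial X (fun _ => 0)) by reflexivity.
  apply functional_extensionality; intro p; unfold flat, nabla, sum2.
  rewrite !christoffel_radial, !met_radial, E, E0, !pd_s_radial, !pd_tau_radial.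
  unfold radial.
  pose proof (cosh_gt_0 (a * tau_of X p)).
  destruct i; cbn [metric_coef christoffel_coef]; field; lra.
Qed.

Lemma NS_parallel_flow (nu : R) (Y : R -> R) (P : scalar) (p : E3) :
  ((forall i : ix,
     nu * (hodge_laplacian X (flat X (parallel_flow a X Y)) i p
           - 2 * ricci_form X (flat X (parallel_flow a X Y)) i p)
     + flat X (nabla X (parallel_flow a X Y) (parallel_flow a X Y)) i p
     + d0 X P i p = 0) /\
   codiff1 X (flat X (parallel_flow a X Y)) p = 0)
  <->
  pd X Itau P p = Y (tau_of X p) ^ 2
                  * (a * sinh (a * tau_of X p) / cosh (a * tau_of X p)) /\
  pd X Is P p = - (nu * shear a Y (tau_of X p)).
Proof.
  rewrite codiff1_parallel_flow; unfold d0, shear, radial.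
  split.
  - intros [H _]; pose proof (H Itau) as H1; pose proof (H Is) as H2.
    rewrite hodge_laplacian_parallel_flow, codiff2_d1_parallel_flow,
      ricci_form_parallel_flow, convection_parallel_flow in H1, H2.
    unfold radial in H1, H2; split; lra.
  - intros [H1 H2]; split; [ | reflexivity ].
    intro i; rewrite hodge_laplacian_parallel_flow, codiff2_d1_parallel_flow,
      ricci_form_parallel_flow, convection_parallel_flow.
    unfold radial; destruct i; [ rewrite H1 | rewrite H2 ]; ring.
Qed.

End CartesianFrame.

(** * Real-analytic functions *)

(** Two-sided neighbourhoods are used throughout, as the explicit profile is analytic on the whole
    line. Since [PSeries] is total, positivity of the radius is demanded separately. *)
Definition analytic_at (f : R -> R) (x : R) : Prop :=
  exists b : nat -> R, Rbar_lt 0 (CV_radius b) /\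
    locally x (fun y => f y = PSeries b (y - x)).

(** The terms of a convergent series tend to 0, which fails strictly outside the disk of
    convergence. *)
Lemma ex_pseries_CV_radius (b : nat -> R) (r : R) :
  0 < r -> ex_pseries b r -> Rbar_le r (CV_radius b).
Proof.
  intros hr Hb; apply Rbar_not_lt_le; intro Hlt.
  apply (CV_disk_outside b r).
  - rewrite Rabs_pos_eq by lra; exact Hlt.
  - apply ex_series_lim_0 in Hb; apply is_lim_seq_ext with (2 := Hb).
    intro n; rewrite pow_n_pow; apply Rmult_comm.
Qed.

Lemma CV_radius_pos_of_ex_pseries (b : nat -> R) (r : R) :
  0 < r -> ex_pseries b r -> Rbar_lt 0 (CV_radius b).
Proof.
  intros hr Hb.
  apply Rbar_lt_le_trans with r; [ exact hr | ].
  apply ex_pseries_CV_radius; assumption.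
Qed.

Lemma Rbar_pos_below (l : Rbar) : Rbar_lt 0 l -> exists r, 0 < r /\ Rbar_lt r l.
Proof.
  destruct l as [l | | ]; cbn; intro H.
  - exists (l / 2); lra.
  - exists 1; split; [ lra | exact I ].
  - contradiction.
Qed.

Lemma common_radius (b c : nat -> R) :
  Rbar_lt 0 (CV_radius b) -> Rbar_lt 0 (CV_radius c) ->
  exists r, 0 < r /\ forall x, Rabs x <= r ->
    Rbar_lt (Rabs x) (CV_radius b) /\ Rbar_lt (Rabs x) (CV_radius c).
Proof.
  intros Hb Hc.
  destruct (Rbar_pos_below _ Hb) as (r1 & h1 & H1).
  destruct (Rbar_pos_below _ Hc) as (r2 & h2 & H2).
  exists (Rmin r1 r2); split; [ apply Rmin_pos; assumption | ].
  intros x Hx; split.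
  - apply Rbar_le_lt_trans with r1; [ | exact H1 ].
    apply Rle_trans with (1 := Hx), Rmin_l.
  - apply Rbar_le_lt_trans with r2; [ | exact H2 ].
    apply Rle_trans with (1 := Hx), Rmin_r.
Qed.

Lemma locally_Rabs (x r : R) : 0 < r -> locally x (fun y => Rabs (y - x) <= r).
Proof.
  intro hr; exists (mkposreal r hr); intros y Hy; apply Rlt_le, Hy.
Qed.

Lemma analytic_at_ext (f g : R -> R) (x : R) :
  (forall y, f y = g y) -> analytic_at f x -> analytic_at g x.
Proof.
  intros E (b & Hb & Hf); exists b; split; [ exact Hb | ].
  revert Hf; apply filter_imp; intros y <-; symmetry; apply E.
Qed.

Lemma analytic_at_plus (f g : R -> R) (x : R) :
  analytic_at f x -> analytic_at g x -> analytic_at (fun y => f y + g y) x.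
Proof.
  intros (b & Hb & Hf) (c & Hc & Hg).
  destruct (common_radius b c Hb Hc) as (r & hr & Hr).
  assert (Ex : forall y, Rabs y <= r -> ex_pseries b y /\ ex_pseries c y).
  { intros y Hy; destruct (Hr y Hy); split; apply CV_radius_inside; assumption. }
  exists (PS_plus b c); split.
  - apply CV_radius_pos_of_ex_pseries with r; [ exact hr | ].
    destruct (Ex r) as [E1 E2]; [ rewrite Rabs_pos_eq; lra | ].
    apply ex_pseries_plus; assumption.
  - pose proof (locally_Rabs x r hr) as Hx.
    generalize (filter_and _ _ Hx (filter_and _ _ Hf Hg)).
    apply filter_imp; intros y (Hy & -> & ->).
    destruct (Ex _ Hy) as [E1 E2]; rewrite PSeries_plus by assumption; reflexivity.
Qed.

Lemma analytic_at_mult (f g : R -> R) (x : R) :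
  analytic_at f x -> analytic_at g x -> analytic_at (fun y => f y * g y) x.
Proof.
  intros (b & Hb & Hf) (c & Hc & Hg).
  destruct (common_radius b c Hb Hc) as (r & hr & Hr).
  exists (PS_mult b c); split.
  - apply CV_radius_pos_of_ex_pseries with r; [ exact hr | ].
    destruct (Hr r) as [E1 E2]; [ rewrite Rabs_pos_eq; lra | ].
    apply ex_pseries_mult; assumption.
  - pose proof (locally_Rabs x r hr) as Hx.
    generalize (filter_and _ _ Hx (filter_and _ _ Hf Hg)).
    apply filter_imp; intros y (Hy & -> & ->).
    destruct (Hr _ Hy) as [E1 E2]; rewrite PSeries_mult by assumption; reflexivity.
Qed.

(** The termwise primitive with constant term F x agrees with F at x and has the same derivative
    nearby. This serves both atan composed with sinh and the tau-part of the pressure. *)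
Lemma analytic_at_primitive (f F : R -> R) (x : R) :
  analytic_at f x -> (forall y, is_derive F y (f y)) -> analytic_at F x.
Proof.
  intros (b & Hb & Hf) HF.
  set (c := fun n => match n with O => F x | S m => b m / INR (S m) end).
  assert (Dc : forall n, PS_derive c n = b n).
  { intro n; unfold PS_derive, c; field; apply not_0_INR; lia. }
  assert (Rc : CV_radius c = CV_radius b).
  { rewrite <- CV_radius_derive; apply CV_radius_ext, Dc. }
  destruct (Rbar_pos_below _ Hb) as (r & hr & Hr).
  exists c; split; [ rewrite Rc; exact Hb | ].
  destruct Hf as [d Hf].
  exists (mkposreal (Rmin r d) (Rmin_pos _ _ hr (cond_pos d))).
  intros y Hy.
  (* The whole segment from x to y stays in the disk of convergence and in the neighbourhood where f
     equals its series, as the mean value theorem requires. *)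
  assert (Hseg : forall z, Rmin x y <= z <= Rmax x y -> Rabs (z - x) < Rmin r d).
  { intros z Hz; apply Rle_lt_trans with (2 := Hy).
    unfold minus, plus, opp, abs; cbn.
    unfold Rmin, Rmax in Hz; destruct (Rle_dec x y) in Hz;
      unfold Rabs; repeat destruct Rcase_abs; lra. }
  assert (D : forall z, Rmin x y <= z <= Rmax x y ->
            is_derive (fun z => F z - PSeries c (z - x)) z 0).
  { intros z Hz; specialize (Hseg z Hz).
    assert (E : f z = PSeries (PS_derive c) (z - x)).
    { rewrite (PSeries_ext _ _ _ Dc); apply Hf.
      apply Rlt_le_trans with (1 := Hseg), Rmin_r. }
    assert (Dz : is_derive (PSeries c) (z - x) (f z)).
    { rewrite E; apply is_derive_PSeries; rewrite Rc.
      apply Rbar_lt_trans with (Finite r); [ | exact Hr ].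
      apply Rlt_le_trans with (1 := Hseg), Rmin_l. }
    specialize (HF z).
    auto_derive_hyps; ring. }
  destruct (MVT_gen (fun z => F z - PSeries c (z - x)) x y (fun _ => 0))
    as (z & _ & Hz).
  - intros z Hz; apply D; lra.
  - intros z Hz; apply (is_derive_continuity_pt _ z 0), D, Hz.
  - rewrite Rminus_diag, PSeries_0 in Hz; cbn [c] in Hz.
    change (c 0%nat) with (F x) in Hz; lra.
Qed.

Lemma is_pseries_const (k x : R) :
  is_pseries (fun n => match n with O => k | S _ => 0 end) x k.
Proof.
  apply is_pseries_R, is_series_decr_1.
  match goal with |- is_series _ ?l => replace l with 0 end.
  - apply is_series_ext with (fun _ => 0); [ intro; cbn; ring | ].
    apply filterlim_ext with (fun _ : nat => 0);
      [ intro n; rewrite sum_n_const; cbn; ring | apply filterlim_const ].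
  - change (0 = k + - (k * 1)); ring.
Qed.

Lemma analytic_at_const (k x : R) : analytic_at (fun _ => k) x.
Proof.
  eexists; split.
  - apply CV_radius_pos_of_ex_pseries with 1;
      [ lra | eexists; apply (is_pseries_const k) ].
  - apply filter_forall; intro y; symmetry.
    apply is_pseries_unique, is_pseries_const.
Qed.

(** The functional equation exp (k y) = exp (k x) exp (k (y - x)) moves the series from 0 to x. *)
Lemma analytic_at_exp (k x : R) : analytic_at (fun y => exp (k * y)) x.
Proof.
  set (b := fun n => exp (k * x) * (k ^ n * / INR (Factorial.fact n))).
  assert (H : forall y, is_pseries b y (exp (k * x) * exp (k * y))).
  { intro y; apply is_pseries_R.
    pose proof (is_exp_Reals (k * y)) as E; apply is_pseries_R in E.
    apply (is_series_scal_l (exp (k * x))) in E.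
    revert E; apply is_series_ext; intro n; unfold b.
    rewrite Rpow_mult_distr; unfold scal, mult; cbn; unfold mult; cbn; ring. }
  exists b; split.
  - apply CV_radius_pos_of_ex_pseries with 1; [ lra | eexists; apply H ].
  - apply filter_forall; intro y; symmetry; apply is_pseries_unique.
    replace (exp (k * y)) with (exp (k * x) * exp (k * (y - x)));
      [ apply H | ].
    rewrite <- exp_plus; f_equal; ring.
Qed.

(** * Reciprocals of power series, through geometric bounds on the coefficients *)

Lemma CV_radius_pos_geometric (b : nat -> R) :
  Rbar_lt 0 (CV_radius b) ->
  exists M K, 0 < M /\ 0 < K /\ forall n, Rabs (b n) <= M * K ^ n.
Proof.
  intro Hb; destruct (Rbar_pos_below _ Hb) as (r & hr & Hr).
  assert (Hr' : Rbar_lt (Rabs r) (CV_radius b))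
    by (rewrite Rabs_pos_eq; [ exact Hr | lra ]).
  apply CV_disk_inside, ex_series_lim_0, is_lim_seq_Reals in Hr'.
  (* The terms |b_n| r^n converge to 0, hence are bounded by some M; the growth rate is then 1 /
     r. *)
  destruct (maj_by_pos _ (exist _ _ Hr')) as (M & hM & HM); exists M, (/ r).
  split; [ exact hM | split; [ apply Rinv_0_lt_compat, hr | ] ].
  intro n; specialize (HM n).
  rewrite Rabs_Rabsolu, Rabs_mult, (Rabs_pos_eq (r ^ n)) in HM
    by (apply pow_le; lra).
  pose proof (pow_lt r n hr) as hn.
  rewrite pow_inv.
  apply Rmult_le_reg_r with (r ^ n); [ exact hn | ].
  rewrite Rmult_assoc, Rinv_l, Rmult_1_r by lra; lra.
Qed.

Lemma geometric_CV_radius_pos (b : nat -> R) (M K : R) :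
  0 < K -> (forall n, Rabs (b n) <= M * K ^ n) -> Rbar_lt 0 (CV_radius b).
Proof.
  intros hK Hb.
  (* At half of the expected radius 1 / K the comparison series is geometric with ratio 1/2. *)
  apply CV_radius_pos_of_ex_pseries with (/ (2 * K));
    [ apply Rinv_0_lt_compat; lra | ].
  apply ex_pseries_R.
  apply (@ex_series_le R_AbsRing R_CompleteNormedModule) with (fun n => M * (/ 2) ^ n).
  - intro n; change (norm _) with (Rabs (b n * (/ (2 * K)) ^ n)).
    rewrite Rabs_mult, (Rabs_pos_eq ((/ (2 * K)) ^ n))
      by (apply pow_le, Rlt_le, Rinv_0_lt_compat; lra).
    replace (/ 2) with (K * / (2 * K)) by (field; lra).
    rewrite Rpow_mult_distr, <- Rmult_assoc.
    apply Rmult_le_compat_r;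
      [ apply pow_le, Rlt_le, Rinv_0_lt_compat; lra | apply Hb ].
  - apply (ex_series_scal_l M (fun n => (/ 2) ^ n)), ex_series_geom.
    rewrite Rabs_pos_eq; lra.
Qed.

(* [recip_table b n] agrees with the coefficients of 1/b up to index n. *)
Fixpoint recip_table (b : nat -> R) (n m : nat) : R :=
  match n with
  | O => / b O
  | S n' =>
      if Nat.leb m n' then recip_table b n' m
      else - / b O * sum_f_R0 (fun k => recip_table b n' k * b (n - k)%nat) n'
  end.

Definition PS_recip (b : nat -> R) (n : nat) : R := recip_table b n n.

Lemma recip_table_stable (b : nat -> R) (n m : nat) :
  (m <= n)%nat -> recip_table b n m = PS_recip b m.
Proof.
  induction n as [ | n IH ]; intro H.
  - replace m with O by lia; reflexivity.
  - destruct (Nat.eq_dec m (S n)) as [-> | Hm]; [ reflexivity | ].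
    cbn [recip_table]; rewrite (proj2 (Nat.leb_le m n)) by lia; apply IH; lia.
Qed.

Lemma PS_recip_S (b : nat -> R) (n : nat) :
  PS_recip b (S n)
  = - / b O * sum_f_R0 (fun k => PS_recip b k * b (S n - k)%nat) n.
Proof.
  unfold PS_recip at 1; cbn [recip_table].
  rewrite (proj2 (Nat.leb_gt (S n) n)) by lia.
  f_equal; apply sum_eq; intros k Hk; f_equal; apply recip_table_stable, Hk.
Qed.

Lemma PS_mult_recip (b : nat -> R) (n : nat) :
  b O <> 0 -> PS_mult (PS_recip b) b n = match n with O => 1 | S _ => 0 end.
Proof.
  intro Hb; unfold PS_mult; destruct n as [ | n ].
  - cbn; field; exact Hb.
  - rewrite tech5, PS_recip_S, Nat.sub_diag.
    set (s := sum_f_R0 _ _); field; exact Hb.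
Qed.

(** Put q = M / |b_0| and L = 1 + q. If the bound (K L)^k / |b_0| holds up to n, the recursion
    bounds the next coefficient by K^(n+1) q (1 + L + ... + L^n) / |b_0|. The choice of L makes q
    times this geometric sum equal to L^(n+1) - 1, so the induction closes. *)
Lemma PS_recip_bound (b : nat -> R) (M K : R) :
  b O <> 0 -> 0 < M -> 0 < K -> (forall n, Rabs (b n) <= M * K ^ n) ->
  forall n, Rabs (PS_recip b n)
            <= / Rabs (b O) * (K * (1 + M / Rabs (b O))) ^ n.
Proof.
  intros Hb hM hK HMK.
  assert (hb : 0 < Rabs (b O)) by (apply Rabs_pos_lt, Hb).
  set (q := M / Rabs (b O)).
  assert (hq : 0 < q) by (apply Rdiv_lt_0_compat; assumption).
  set (L := 1 + q).
  assert (hL : 0 < L) by (unfold L; lra).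
  assert (Hsum : forall n, q * sum_f_R0 (fun k => L ^ k) n + 1 = L ^ S n).
  { intro n; induction n as [ | n IH ]; [ cbn; unfold L; ring | ].
    rewrite tech5; change (L ^ S (S n)) with (L * L ^ S n).
    unfold L at 3; lra. }
  intro n; induction n as [n IH] using lt_wf_ind.
  destruct n as [ | n ].
  - change (PS_recip b 0) with (/ b O).
    rewrite Rabs_inv; cbn; lra.
  - rewrite PS_recip_S, Rabs_mult, Rabs_Ropp, Rabs_inv.
    apply Rmult_le_compat_l; [ apply Rlt_le, Rinv_0_lt_compat, hb | ].
    apply Rle_trans with
      (sum_f_R0 (fun k => L ^ k * (q * K ^ S n)) n).
    + eapply Rle_trans; [ apply Rsum_abs | ].
      apply sum_Rle; intros k Hk.
      rewrite Rabs_mult.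
      eapply Rle_trans;
        [ apply Rmult_le_compat; [ apply Rabs_pos | apply Rabs_pos
          | apply IH; lia | apply HMK ] | ].
      right; fold q; fold L; rewrite Rpow_mult_distr.
      replace (K ^ S n) with (K ^ k * K ^ (S n - k))
        by (rewrite <- pow_add; f_equal; lia).
      unfold q; field; lra.
    + rewrite <- scal_sum.
      fold q; fold L; rewrite Rpow_mult_distr, <- Hsum.
      pose proof (pow_lt K (S n) hK).
      change (sum_f_R0 (pow L) n) with (sum_f_R0 (fun k => L ^ k) n); lra.
Qed.

Lemma analytic_at_inv (f : R -> R) (x : R) :
  analytic_at f x -> f x <> 0 -> analytic_at (fun y => / f y) x.
Proof.
  intros (b & Hb & Hf) Hx.
  assert (Hb0 : b O <> 0).
  { apply locally_singleton in Hf; rewrite Rminus_diag, PSeries_0 in Hf.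
    rewrite <- Hf; exact Hx. }
  assert (Hc : Rbar_lt 0 (CV_radius (PS_recip b))).
  { destruct (CV_radius_pos_geometric b Hb) as (M & K & hM & hK & HMK).
    apply geometric_CV_radius_pos with (2 := PS_recip_bound b M K Hb0 hM hK HMK).
    apply Rmult_lt_0_compat; [ exact hK | ].
    assert (0 < M / Rabs (b O))
      by (apply Rdiv_lt_0_compat; [ exact hM | apply Rabs_pos_lt, Hb0 ]).
    lra. }
  destruct (common_radius _ _ Hb Hc) as (r & hr & Hr).
  exists (PS_recip b); split; [ exact Hc | ].
  generalize (filter_and _ _ (locally_Rabs x r hr) Hf).
  apply filter_imp; intros y (Hy & ->).
  destruct (Hr _ Hy) as [E1 E2].
  assert (E : PSeries (PS_recip b) (y - x) * PSeries b (y - x) = 1).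
  { rewrite <- PSeries_mult by assumption.
    rewrite (PSeries_ext _ _ _ (fun n => PS_mult_recip b n Hb0)).
    apply is_pseries_unique, is_pseries_const. }
  assert (PSeries b (y - x) <> 0) by (intro Z; rewrite Z in E; lra).
  apply Rmult_eq_reg_r with (PSeries b (y - x)); [ | assumption ].
  rewrite E; field; assumption.
Qed.

Lemma analytic_ex_derive_n (f : R -> R) :
  (forall x, analytic_at f x) -> forall n x, ex_derive_n f n x.
Proof.
  intros Hf n x; destruct (Hf x) as (b & Hb & Hx).
  apply ex_derive_n_ext_loc with (fun y => PSeries b (y + - x)).
  - revert Hx; apply filter_imp; intros y ->; reflexivity.
  - apply (ex_derive_n_comp_trans (PSeries b)), ex_derive_n_PSeries.
    rewrite Rplus_opp_r, Rabs_R0; exact Hb.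
Qed.

Lemma analytic_on_halfline (f : R -> R) :
  (forall x, analytic_at f x) -> real_analytic_on_halfline f.
Proof.
  intros Hf x _; destruct (Hf x) as (b & Hb & Hx).
  destruct (common_radius b b Hb Hb) as (r & hr & Hr).
  destruct Hx as [d Hd].
  exists b, (Rmin r d); split; [ apply Rmin_pos; [ exact hr | apply cond_pos ] | ].
  intros y _ Hy.
  rewrite Hd by (apply Rlt_le_trans with (1 := Hy), Rmin_r).
  apply PSeries_correct, CV_radius_inside, Hr.
  apply Rlt_le, Rlt_le_trans with (1 := Hy), Rmin_l.
Qed.

(** * The profile equation *)

(** At the endpoints only continuity is asked for, so the interval may start at 0, where competitors
    have one-sided derivatives. *)
Lemma zero_derive_interval (f : R -> R) (x y : R) :
  x <= y -> (forall z, x <= z <= y -> continuity_pt f z) ->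
  (forall z, x < z < y -> is_derive f z 0) -> f x = f y.
Proof.
  intros Hxy Hc Hd.
  destruct (MVT_gen f x y (fun _ => 0)) as (z & _ & Hz);
    rewrite ?Rmin_left, ?Rmax_right by exact Hxy; auto; lra.
Qed.

(** Instead of exchanging mixed partials of P, compare P at s = 1 and s = 0. The s-equation makes
    the jump equal to - nu [shear], and the tau-equation makes it constant. Only first partials of P
    occur, and Y is arbitrary. *)
Lemma solves_NS_shear_constant (a : R) (ha : 0 < a) (X : chart) (O e w : E3)
  (nu : R) (hnu : 0 < nu) (U : E3 -> Prop) (Y : R -> R) (t1 t2 : R) :
  cartesian_frame a X O e w -> solves_NS X nu U (parallel_flow a X Y) ->
  t1 <= t2 -> (forall t y, t1 <= t <= t2 -> U (Phi X t y)) ->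
  shear a Y t1 = shear a Y t2.
Proof.
  intros HX (P & HP & HNS) Ht HU.
  assert (Dt : forall t y, t1 <= t <= t2 ->
    is_derive (fun x => P (Phi X x y)) t
      (Y t ^ 2 * (a * sinh (a * t) / cosh (a * t)))).
  { intros t y Hty.
    destruct (HP 1%nat) as [_ H]; destruct (H Itau) as [H1 _].
    specialize (H1 _ (HU t y Hty)).
    destruct (proj1 (NS_parallel_flow a ha X O e w HX nu Y P _)
                (HNS _ (HU t y Hty))) as [E _].
    unfold ex_pd in H1; unfold pd in E.
    rewrite (frame_tau _ _ _ _ _ HX), (frame_s _ _ _ _ _ HX) in H1, E.
    rewrite <- E; apply Derive_correct, H1. }
  assert (Ds : forall t y, t1 <= t <= t2 ->
    is_derive (fun x => P (Phi X t x)) y (- (nu * shear a Y t))).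
  { intros t y Hty.
    destruct (HP 1%nat) as [_ H]; destruct (H Is) as [H1 _].
    specialize (H1 _ (HU t y Hty)).
    destruct (proj1 (NS_parallel_flow a ha X O e w HX nu Y P _)
                (HNS _ (HU t y Hty))) as [_ E].
    unfold ex_pd in H1; unfold pd in E.
    rewrite (frame_tau _ _ _ _ _ HX), (frame_s _ _ _ _ _ HX) in H1, E.
    rewrite <- E; apply Derive_correct, H1. }
  assert (Jump : forall t, t1 <= t <= t2 ->
    P (Phi X t 1) - P (Phi X t 0) = - (nu * shear a Y t)).
  { intros t Hty.
    destruct (MVT_gen (fun y => P (Phi X t y)) 0 1
                (fun _ => - (nu * shear a Y t))) as (z & _ & Hz).
    - intros y _; apply Ds, Hty.
    - intros y _; eapply is_derive_continuity_pt, Ds, Hty.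
    - rewrite Hz; ring. }
  (* dP/dtau does not depend on s, so the jump of P in s is constant in tau. *)
  assert (E : P (Phi X t1 1) - P (Phi X t1 0) = P (Phi X t2 1) - P (Phi X t2 0)).
  { assert (D0 : forall t, t1 <= t <= t2 ->
      is_derive (fun t => P (Phi X t 1) - P (Phi X t 0)) t 0).
    { intros t Hty.
      pose proof (is_derive_minus _ _ _ _ _ (Dt t 1 Hty) (Dt t 0 Hty)) as D.
      rewrite minus_eq_zero in D; exact D. }
    apply (zero_derive_interval (fun t => P (Phi X t 1) - P (Phi X t 0)));
      [ exact Ht | | ].
    - intros t Hty; eapply is_derive_continuity_pt, D0, Hty.
    - intros t Hty; apply D0; lra. }
  rewrite !Jump in E by lra; nra.
Qed.

(** [shear] with its nested derivatives expanded, where y0, y1, y2 stand for Y, Y', Y'' at t. It is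
    linear in them, and at t = 0 with y0 = 0 it reduces to y2. *)
Definition shear_op (a t y0 y1 y2 : R) : R :=
  cosh (a * t) * y2 + a * sinh (a * t) * y1
  + (a ^ 2 / cosh (a * t) - 2 * a ^ 2 * cosh (a * t)) * y0.

Lemma shear_eq (a t : R) (Y Y1 : R -> R) (y2 : R) :
  locally t (fun x => is_derive Y x (Y1 x)) -> is_derive Y1 t y2 ->
  shear a Y t = shear_op a t (Y t) (Y1 t) y2.
Proof.
  intros HY HY1; unfold shear, shear_op.
  assert (Hc := fun x => Rgt_not_eq _ _ (cosh_gt_0 x)).
  rewrite (Derive_ext_loc _ (fun x => Y1 x + Y x * (a * sinh (a * x) / cosh (a * x)))).
  - apply locally_singleton in HY.
    rewrite (is_derive_unique _ _
      (y2 + (Y1 t * (a * sinh (a * t) / cosh (a * t))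
             + Y t * (a ^ 2 / cosh (a * t) ^ 2)))).
    + field; apply Hc.
    + pose proof (cosh_sqr (a * t)) as E.
      replace (a ^ 2 / cosh (a * t) ^ 2)
        with (a ^ 2 * (cosh (a * t) ^ 2 - sinh (a * t) ^ 2) / cosh (a * t) ^ 2)
        by (rewrite E; f_equal; ring).
      auto_derive;
        [ repeat split; try (eexists; eassumption); apply Hc
        | rewrite_derive_hyps; field; apply Hc ].
  - revert HY; apply filter_imp; intros x HY.
    rewrite (is_derive_unique _ _ (Y1 x * cosh (a * x) + Y x * (a * sinh (a * x)))).
    + field; apply Hc.
    + auto_derive_hyps; ring.
Qed.

Lemma shear_smooth (a : R) (Y Y1 Y2 : R -> R) (t : R) :
  (forall x, is_derive Y x (Y1 x)) -> (forall x, is_derive Y1 x (Y2 x)) ->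
  shear a Y t = shear_op a t (Y t) (Y1 t) (Y2 t).
Proof.
  intros H1 H2; apply shear_eq; [ apply filter_forall, H1 | apply H2 ].
Qed.

Lemma continuity_pt_right_value (f : R -> R) (b k : R) :
  0 < b -> continuity_pt f 0 -> (forall x, 0 < x < b -> f x = k) -> f 0 = k.
Proof.
  intros hb Hc Hk.
  apply cond_eq; intros eps heps.
  destruct (Hc eps heps) as (d & hd & Hd).
  set (x := Rmin d b / 2).
  pose proof (Rmin_l d b); pose proof (Rmin_r d b).
  assert (0 < Rmin d b) by (apply Rmin_pos; assumption).
  assert (0 < x < b) by (unfold x; lra).
  rewrite <- (Hk x), Rabs_minus_sym by assumption.
  apply Hd; split; [ split; [ exact I | lra ] | ].
  cbn; unfold Rdist; rewrite Rabs_pos_eq by lra; unfold x; lra.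
Qed.

Lemma derive_zero_fun (f : R -> R) (b x l : R) :
  (forall y, 0 < y < b -> f y = 0) -> 0 < x < b -> is_derive f x l -> l = 0.
Proof.
  intros Hf Hx D.
  rewrite <- (is_derive_unique _ _ _ D), (Derive_ext_loc _ (fun _ => 0)).
  - apply Derive_const.
  - assert (H : locally x (fun y => 0 < y /\ y < b)).
    { apply filter_and; [ apply open_gt | apply open_lt ]; apply Hx. }
    revert H; apply filter_imp; exact Hf.
Qed.

(* The second tau-derivative at 0 of cosh * (shear - s) is -2 a^2 alpha2. *)
Lemma quadratic_shear_not_constant (a alpha1 alpha2 tau0 s : R) :
  0 < a -> 0 < alpha2 -> 0 < tau0 ->
  ~ (forall t, 0 < t < tau0 ->
      shear a (fun x => alpha1 * x - alpha2 / 2 * x ^ 2) t = s).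
Proof.
  intros ha h2 h0 H.
  set (h := fun x => alpha1 * x - alpha2 / 2 * x ^ 2).
  (* The factor cosh clears the quotient in [shear_op], leaving polynomials in cosh, sinh and t;
     [F1] and [F2] are the first two derivatives of [F]. All three vanish inside the strip, and
     continuity carries this to 0 for [F] and [F2]. *)
  set (F := fun t => - alpha2 * cosh (a * t) ^ 2
    + a * (sinh (a * t) * cosh (a * t) * (alpha1 - alpha2 * t))
    + (a ^ 2 - 2 * a ^ 2 * cosh (a * t) ^ 2) * h t - s * cosh (a * t)).
  set (F1 := fun t => - 3 * alpha2 * a * (cosh (a * t) * sinh (a * t))
    + a ^ 2 * (cosh (a * t) ^ 2 + sinh (a * t) ^ 2) * (alpha1 - alpha2 * t)
    - 4 * a ^ 3 * (cosh (a * t) * sinh (a * t)) * h t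
    + (a ^ 2 - 2 * a ^ 2 * cosh (a * t) ^ 2) * (alpha1 - alpha2 * t)
    - s * a * sinh (a * t)).
  set (F2 := fun t =>
    - 4 * alpha2 * a ^ 2 * (cosh (a * t) ^ 2 + sinh (a * t) ^ 2)
    - 4 * a ^ 3 * (cosh (a * t) * sinh (a * t)) * (alpha1 - alpha2 * t)
    - 4 * a ^ 4 * (cosh (a * t) ^ 2 + sinh (a * t) ^ 2) * h t
    - alpha2 * (a ^ 2 - 2 * a ^ 2 * cosh (a * t) ^ 2)
    - s * a ^ 2 * cosh (a * t)).
  assert (D1 : forall t, is_derive F t (F1 t)).
  { intro t; unfold F, F1, h; auto_derive; [ auto | field ]. }
  assert (D2 : forall t, is_derive F1 t (F2 t)).
  { intro t; unfold F1, F2, h; auto_derive; [ auto | field ]. }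
  assert (D3 : ex_derive F2 0) by (unfold F2, h; auto_derive; auto).
  assert (E0 : forall t, 0 < t < tau0 -> F t = 0).
  { intros t Ht; specialize (H t Ht).
    rewrite (shear_smooth a _ (fun x => alpha1 - alpha2 * x) (fun _ => - alpha2))
      in H by (intro; auto_derive; [ auto | field ]).
    pose proof (cosh_gt_0 (a * t)).
    transitivity (cosh (a * t)
      * (shear_op a t (h t) (alpha1 - alpha2 * t) (- alpha2) - s)).
    - unfold F, shear_op; field; lra.
    - unfold h; rewrite H; ring. }
  assert (E1 : forall t, 0 < t < tau0 -> F1 t = 0)
    by (intros t Ht; apply (derive_zero_fun F tau0 t); auto).
  assert (E2 : forall t, 0 < t < tau0 -> F2 t = 0)
    by (intros t Ht; apply (derive_zero_fun F1 tau0 t); auto).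
  assert (Z0 : F 0 = 0)
    by (apply (continuity_pt_right_value F tau0); auto;
        eapply is_derive_continuity_pt, D1).
  assert (Z2 : F2 0 = 0)
    by (apply (continuity_pt_right_value F2 tau0); auto;
        destruct D3 as [l D3]; eapply is_derive_continuity_pt, D3).
  (* At 0 the first equation reads s = - alpha2; with this value the second becomes -2 a^2 alpha2 =
     0. *)
  unfold F in Z0; unfold F2 in Z2; unfold h in Z0, Z2.
  rewrite Rmult_0_r, cosh_0, sinh_0 in Z0, Z2.
  assert (0 < a ^ 2 * alpha2)
    by (apply Rmult_lt_0_compat; [ apply pow_lt | ]; assumption).
  nra.
Qed.

(** For k = - alpha2 the constant solution gives alpha2 / (2 a^2 cosh), and Y(0) = 0 then fixes the
    multiple of the homogeneous solution cosh. The other homogeneous solution has slope 2 a at 0,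
    whence the factor alpha1 / (2 a). *)
Definition laminar_profile (a alpha1 alpha2 t : R) : R :=
  alpha1 / (2 * a) * (sinh (a * t) * / cosh (a * t)
                      + cosh (a * t) * atan (sinh (a * t)))
  - alpha2 / (2 * a ^ 2) * (cosh (a * t) - / cosh (a * t)).

Definition laminar_profile' (a alpha1 alpha2 t : R) : R :=
  alpha1 / 2 * (/ cosh (a * t) ^ 2 + sinh (a * t) * atan (sinh (a * t)) + 1)
  - alpha2 / (2 * a) * (sinh (a * t) + sinh (a * t) / cosh (a * t) ^ 2).

Definition laminar_profile'' (a alpha1 alpha2 t : R) : R :=
  alpha1 * a / 2 * (- 2 * sinh (a * t) / cosh (a * t) ^ 3
    + cosh (a * t) * atan (sinh (a * t)) + sinh (a * t) / cosh (a * t))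
  - alpha2 / 2 * (cosh (a * t) + / cosh (a * t)
                  - 2 * sinh (a * t) ^ 2 / cosh (a * t) ^ 3).

Lemma is_derive_laminar_profile (a alpha1 alpha2 t : R) : 0 < a ->
  is_derive (laminar_profile a alpha1 alpha2) t (laminar_profile' a alpha1 alpha2 t).
Proof.
  intro ha; pose proof (cosh_gt_0 (a * t)) as hc.
  pose proof (cosh_sqr (a * t)) as E.
  unfold laminar_profile, laminar_profile'.
  auto_derive; [ repeat split; lra | ].
  (* This is the form in which [auto_derive] leaves the denominator 1 + sinh^2 coming from atan. *)
  replace (1 + sinh (a * t) * (sinh (a * t) * 1)) with (cosh (a * t) ^ 2)
    by (rewrite E; ring).
  field [E]; lra.
Qed.

Lemma is_derive_laminar_profile' (a alpha1 alpha2 t : R) : 0 < a ->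
  is_derive (laminar_profile' a alpha1 alpha2) t
    (laminar_profile'' a alpha1 alpha2 t).
Proof.
  intro ha; pose proof (cosh_gt_0 (a * t)) as hc.
  pose proof (cosh_sqr (a * t)) as E.
  unfold laminar_profile', laminar_profile''.
  auto_derive; [ repeat split; nra | ].
  replace (1 + sinh (a * t) * (sinh (a * t) * 1)) with (cosh (a * t) ^ 2)
    by (rewrite E; ring).
  field [E]; lra.
Qed.

Lemma shear_laminar_profile (a alpha1 alpha2 t : R) : 0 < a ->
  shear_op a t (laminar_profile a alpha1 alpha2 t)
    (laminar_profile' a alpha1 alpha2 t) (laminar_profile'' a alpha1 alpha2 t)
  = - alpha2.
Proof.
  intro ha; pose proof (cosh_gt_0 (a * t)) as hc.
  pose proof (cosh_sqr (a * t)) as E.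
  unfold shear_op, laminar_profile, laminar_profile', laminar_profile''.
  field [E]; lra.
Qed.

(** * Analyticity of the explicit profile *)

Lemma analytic_at_scal (f : R -> R) (k x : R) :
  analytic_at f x -> analytic_at (fun y => k * f y) x.
Proof. intro H; apply analytic_at_mult; [ apply analytic_at_const | exact H ]. Qed.

Lemma analytic_at_cosh (a x : R) : analytic_at (fun t => cosh (a * t)) x.
Proof.
  apply analytic_at_ext with (fun t => / 2 * (exp (a * t) + exp (- a * t))).
  - intro t; unfold cosh; replace (- (a * t)) with (- a * t) by ring; lra.
  - apply analytic_at_scal, analytic_at_plus; apply analytic_at_exp.
Qed.

Lemma analytic_at_sinh (a x : R) : analytic_at (fun t => sinh (a * t)) x.
Proof.
  apply analytic_at_ext with (fun t => / 2 * (exp (a * t) + -1 * exp (- a * t))).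
  - intro t; unfold sinh; replace (- (a * t)) with (- a * t) by ring; lra.
  - apply analytic_at_scal, analytic_at_plus;
      [ | apply analytic_at_scal ]; apply analytic_at_exp.
Qed.

Lemma analytic_at_inv_cosh (a x : R) : analytic_at (fun t => / cosh (a * t)) x.
Proof.
  apply analytic_at_inv; [ apply analytic_at_cosh | ].
  apply Rgt_not_eq, cosh_gt_0.
Qed.

(* The Gudermannian: its derivative a / cosh is analytic. *)
Lemma analytic_at_atan_sinh (a x : R) :
  analytic_at (fun t => atan (sinh (a * t))) x.
Proof.
  apply analytic_at_primitive with (fun t => a * / cosh (a * t)).
  - apply analytic_at_scal, analytic_at_inv_cosh.
  - intro t; pose proof (cosh_gt_0 (a * t)); pose proof (cosh_sqr (a * t)) as E.
    auto_derive; [ exact I | ].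
    replace (1 + sinh (a * t) * (sinh (a * t) * 1)) with (cosh (a * t) ^ 2)
      by (rewrite E; ring).
    field; lra.
Qed.

Lemma analytic_at_laminar_profile (a alpha1 alpha2 x : R) :
  analytic_at (laminar_profile a alpha1 alpha2) x.
Proof.
  apply analytic_at_ext with (fun t =>
    alpha1 / (2 * a) * (sinh (a * t) * / cosh (a * t)
                        + cosh (a * t) * atan (sinh (a * t)))
    + - (alpha2 / (2 * a ^ 2)) * (cosh (a * t) + -1 * / cosh (a * t))).
  - intro t; unfold laminar_profile; ring.
  - repeat first
      [ apply analytic_at_cosh | apply analytic_at_sinh
      | apply analytic_at_inv_cosh | apply analytic_at_atan_sinh
      | apply analytic_at_scal | apply analytic_at_plus
      | apply analytic_at_mult ].
Qed.

(** * Construction of the pressure *)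

Lemma continuous_primitive (f : R -> R) :
  (forall x, continuous f x) -> exists F, forall x, is_derive F x (f x).
Proof.
  intro Hf; exists (fun x => RInt f 0 x); intro x.
  apply (is_derive_RInt f (RInt f 0) 0 x); [ | apply Hf ].
  apply filter_forall; intro y.
  apply (RInt_correct (V := R_CompleteNormedModule) f 0 y).
  apply (ex_RInt_continuous (V := R_CompleteNormedModule)); intros; apply Hf.
Qed.

(** The summand with factor 0 keeps the derivative in the class q(tau) + k s, so that the induction
    in [class_C_separable] closes. *)
Lemma pd_tau_separable (a : R) (X : chart) (O e w : E3) (q : R -> R) (k : R) :
  cartesian_frame a X O e w -> (forall x, ex_derive q x) ->
  pd X Itau (fun p => q (tau_of X p) + k * s_of X p)
  = fun p => Derive q (tau_of X p) + 0 * s_of X p.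
Proof.
  intros HX Hq; apply functional_extensionality; intro p; unfold pd.
  rewrite (Derive_ext _ (fun t => q t + k * s_of X p)).
  - apply is_derive_unique; auto_derive; [ apply Hq | ].
    change (Derive (fun x => q x)) with (Derive q); ring.
  - intro t; rewrite (frame_tau _ _ _ _ _ HX), (frame_s _ _ _ _ _ HX).
    reflexivity.
Qed.

Lemma pd_s_separable (a : R) (X : chart) (O e w : E3) (q : R -> R) (k : R) :
  cartesian_frame a X O e w ->
  pd X Is (fun p => q (tau_of X p) + k * s_of X p)
  = fun p => k + 0 * s_of X p.
Proof.
  intro HX; apply functional_extensionality; intro p; unfold pd.
  rewrite (Derive_ext _ (fun y => q (tau_of X p) + k * y)).
  - apply is_derive_unique; auto_derive; [ exact I | ring ].
  - intro t; rewrite (frame_tau _ _ _ _ _ HX), (frame_s _ _ _ _ _ HX).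
    reflexivity.
Qed.

Lemma class_C_separable (a : R) (X : chart) (O e w : E3) (n : nat)
  (U : E3 -> Prop) (q : R -> R) (k : R) :
  cartesian_frame a X O e w -> (forall m x, ex_derive_n q m x) ->
  class_C X n U (fun p => q (tau_of X p) + k * s_of X p).
Proof.
  intro HX; revert q k; induction n as [ | n IH ]; intros q k Hq.
  all: cbn [class_C]; split.
  1, 3: intros p _.
  1, 2: apply continuity_2d_pt_ext with (fun t y => q t + k * y);
    [ intros; rewrite (frame_tau _ _ _ _ _ HX), (frame_s _ _ _ _ _ HX);
      reflexivity | ].
  1, 2: apply continuity_2d_pt_plus;
    [ apply (continuity_1d_2d_pt_comp q (fun t _ => t));
      [ destruct (Hq 1%nat (tau_of X p)) as [l Hl];
        apply (is_derive_continuity_pt _ _ l), Hl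
      | apply continuity_2d_pt_id1 ]
    | apply continuity_2d_pt_mult;
      [ apply continuity_2d_pt_const | apply continuity_2d_pt_id2 ] ].
  - exact I.
  - intro i; split.
    + intros p _; destruct i; unfold ex_pd.
      * apply ex_derive_ext with (fun t => q t + k * s_of X p).
        -- intro t; rewrite (frame_tau _ _ _ _ _ HX), (frame_s _ _ _ _ _ HX).
           reflexivity.
        -- specialize (Hq 1%nat (tau_of X p)); cbn in Hq; auto_derive; auto.
      * apply ex_derive_ext with (fun y => q (tau_of X p) + k * y).
        -- intro t; rewrite (frame_tau _ _ _ _ _ HX), (frame_s _ _ _ _ _ HX).
           reflexivity.
        -- auto_derive; exact I.
    + destruct i.
      * rewrite (pd_tau_separable _ _ _ _ _ _ _ HX) by apply (Hq 1%nat).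
        apply IH.
        intros m x; destruct m as [ | m ]; [ exact I | ].
        specialize (Hq (S (S m)) x); revert Hq.
        apply ex_derive_ext; intro y.
        rewrite <- (Nat.add_1_r m); symmetry; apply (Derive_n_comp q m 1).
      * rewrite (pd_s_separable _ _ _ _ _ _ _ HX); apply (IH (fun _ => k)).
        intros m x; apply ex_derive_n_const.
Qed.

Lemma solves_NS_of_shear_constant (a : R) (ha : 0 < a) (X : chart) (O e w : E3)
  (nu : R) (U : E3 -> Prop) (Y : R -> R) (k : R) :
  cartesian_frame a X O e w -> (forall x, analytic_at Y x) ->
  (forall p, U p -> shear a Y (tau_of X p) = k) ->
  solves_NS X nu U (parallel_flow a X Y).
Proof.
  intros HX HY Hk.
  set (f := fun t => Y t * Y t * (a * (sinh (a * t) * / cosh (a * t)))).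
  assert (Hf : forall x, analytic_at f x).
  { intro x; unfold f; repeat first
      [ apply HY | apply analytic_at_sinh | apply analytic_at_inv_cosh
      | apply analytic_at_scal | apply analytic_at_mult ]. }
  destruct (continuous_primitive f) as [q Hq].
  { intro x; apply (ex_derive_continuous (V := R_NormedModule)).
    apply (analytic_ex_derive_n f Hf 1%nat). }
  assert (Hqn : forall m x, ex_derive_n q m x).
  { apply analytic_ex_derive_n; intro x; apply analytic_at_primitive with f; auto. }
  (* q is a primitive of the centrifugal term, and the part linear in s balances the constant
     viscous force. *)
  exists (fun p => q (tau_of X p) + - (nu * k) * s_of X p); split.
  - intro n; apply (class_C_separable a X O e w); assumption.
  - intros p Hp; apply (NS_parallel_flow a ha X O e w HX).
    rewrite (pd_tau_separable _ _ _ _ _ _ _ HX (Hqn 1%nat)),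
      (pd_s_separable _ _ _ _ _ _ _ HX).
    rewrite (is_derive_unique _ _ _ (Hq _)), (Hk p Hp); unfold f; split.
    + pose proof (cosh_gt_0 (a * tau_of X p)); field; lra.
    + ring.
Qed.

(** * The jet at 0 and uniqueness on the half-line *)

Lemma laminar_profile_jet (a alpha1 alpha2 : R) : 0 < a ->
  smooth_with_jet (laminar_profile a alpha1 alpha2) 0 alpha1 (- alpha2).
Proof.
  intro ha.
  assert (H1 : forall t, Derive (laminar_profile a alpha1 alpha2) t
                         = laminar_profile' a alpha1 alpha2 t)
    by (intro; apply is_derive_unique, is_derive_laminar_profile, ha).
  exists (Derive_n (laminar_profile a alpha1 alpha2)).
  split; [ split; [ reflexivity | ] | split; [ | split ] ].
  - intros k x _.
    apply (limit1_imp _ (D_x no_cond x)).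
    + intros y [_ Hy]; split; [ exact I | exact Hy ].
    + apply derivable_pt_lim_D_in, is_derive_Reals, Derive_correct.
      apply (analytic_ex_derive_n _ (analytic_at_laminar_profile a alpha1 alpha2) (S k)).
  - cbn; unfold laminar_profile.
    rewrite Rmult_0_r, sinh_0, cosh_0, atan_0; field; lra.
  - change (Derive (laminar_profile a alpha1 alpha2) 0 = alpha1); rewrite H1.
    unfold laminar_profile'; rewrite Rmult_0_r, sinh_0, cosh_0, atan_0; field; lra.
  - change (Derive (Derive (laminar_profile a alpha1 alpha2)) 0 = - alpha2).
    rewrite (Derive_ext _ _ _ H1), (is_derive_unique _ _ _
      (is_derive_laminar_profile' a alpha1 alpha2 0 ha)).
    unfold laminar_profile''; rewrite Rmult_0_r, sinh_0, cosh_0, atan_0; field; lra.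
Qed.

(** Composition with [Rabs] replaces the arbitrary values at negative arguments by an even
    extension. It equals f near any x > 0, so one-sided hypotheses turn into two-sided derivatives
    there; at 0 it is merely continuous in general. *)
Lemma D_in_halfline_derive (f g : R -> R) (x : R) :
  0 < x -> D_in f g (fun y => 0 <= y) x ->
  is_derive (fun y => f (Rabs y)) x (g (Rabs x)).
Proof.
  intros hx H; apply is_derive_Reals; intros eps heps.
  destruct (H eps heps) as (d & hd & Hd).
  exists (mkposreal _ (Rmin_pos _ _ hd hx)); intros h h0 Hh; cbn in Hh.
  pose proof (Rmin_l d x); pose proof (Rmin_r d x).
  assert (Hxh : 0 <= x + h)
    by (pose proof (Rcomplements.Rabs_lt_between h (Rmin d x)); lra).
  specialize (Hd (x + h)).
  rewrite (Rabs_pos_eq (x + h)), (Rabs_pos_eq x) by lra.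
  replace (x + h - x) with h in Hd by ring.
  apply Hd; split; [ split; [ exact Hxh | intro; apply h0; lra ] | ].
  cbn; unfold Rdist; replace (x + h - x) with h by ring; lra.
Qed.

Lemma D_in_halfline_continuity (f g : R -> R) :
  D_in f g (fun y => 0 <= y) 0 -> continuity_pt (fun y => f (Rabs y)) 0.
Proof.
  intro H; apply cont_deriv in H; intros eps heps.
  destruct (H eps heps) as (d & hd & Hd); exists d; split; [ exact hd | ].
  intros x [[_ Hx] Hxd]; rewrite Rabs_R0; apply Hd; cbn in *; unfold Rdist in *.
  rewrite Rminus_0_r in *; rewrite Rabs_Rabsolu.
  split; [ split; [ apply Rabs_pos | ] | exact Hxd ].
  intro E; apply Hx; symmetry in E; destruct (Req_dec x 0) as [-> | N];
    [ reflexivity | ]; apply Rabs_no_R0 in N; contradiction.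
Qed.

Lemma continuity_pt_lincomb (g1 f1 g2 f2 : R -> R) (x : R) :
  continuity_pt g1 x -> continuity_pt f1 x ->
  continuity_pt g2 x -> continuity_pt f2 x ->
  continuity_pt (fun t => g1 t * f1 t + g2 t * f2 t) x.
Proof.
  intros; apply (continuity_pt_plus (fun t => g1 t * f1 t) (fun t => g2 t * f2 t));
    apply continuity_pt_mult; assumption.
Qed.

Lemma ex_derive_continuity_pt (f : R -> R) (x : R) :
  ex_derive f x -> continuity_pt f x.
Proof. intros [l H]; apply (is_derive_continuity_pt f x l H). Qed.

Lemma continuity_shear_op (a : R) (y0 y1 y2 : R -> R) (x : R) :
  continuity_pt y0 x -> continuity_pt y1 x -> continuity_pt y2 x ->
  continuity_pt (fun t => shear_op a t (y0 t) (y1 t) (y2 t)) x.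
Proof.
  intros h0 h1 h2.
  apply (continuity_pt_plus
    (fun t => cosh (a * t) * y2 t + a * sinh (a * t) * y1 t)
    (fun t => (a ^ 2 / cosh (a * t) - 2 * a ^ 2 * cosh (a * t)) * y0 t)).
  - apply (continuity_pt_lincomb (fun t => cosh (a * t)) _
             (fun t => a * sinh (a * t))); auto;
      apply ex_derive_continuity_pt; auto_derive; auto.
  - apply continuity_pt_mult; [ | exact h0 ].
    apply ex_derive_continuity_pt; auto_derive; auto.
    apply Rgt_not_eq, cosh_gt_0.
Qed.

(* cosh^2 solves the homogeneous equation for E cosh; cosh (E' cosh - E cosh')
   is the Wronskian divided by the integrating factor cosh. *)
Lemma shear_op_unique (a : R) (e0 e1 e2 : R -> R) :
  continuity_pt e0 0 -> continuity_pt e1 0 ->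
  (forall x, 0 < x -> is_derive e0 x (e1 x)) ->
  (forall x, 0 < x -> is_derive e1 x (e2 x)) ->
  (forall x, 0 < x -> shear_op a x (e0 x) (e1 x) (e2 x) = 0) ->
  e0 0 = 0 -> e1 0 = 0 -> forall x, 0 <= x -> e0 x = 0.
Proof.
  intros c0 c1 d0 d1 Hs z0 z1.
  assert (C0 : forall x, 0 <= x -> continuity_pt e0 x).
  { intros x [hx | <-]; [ eapply is_derive_continuity_pt, d0, hx | exact c0 ]. }
  assert (C1 : forall x, 0 <= x -> continuity_pt e1 x).
  { intros x [hx | <-]; [ eapply is_derive_continuity_pt, d1, hx | exact c1 ]. }
  (* The derivative of m is cosh times [shear_op], hence zero. *)
  set (m := fun t => cosh (a * t) ^ 2 * e1 t
                     + - (a * (cosh (a * t) * sinh (a * t))) * e0 t).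
  assert (Hm : forall x, 0 <= x -> m x = 0).
  { intros x hx; transitivity (m 0).
    - symmetry; apply zero_derive_interval; [ exact hx | | ].
      + intros z Hz; apply (continuity_pt_lincomb
          (fun t => cosh (a * t) ^ 2) e1
          (fun t => - (a * (cosh (a * t) * sinh (a * t)))) e0);
          [ | apply C1; lra | | apply C0; lra ];
          apply ex_derive_continuity_pt; auto_derive; auto.
      + intros z Hz; assert (hz : 0 < z) by lra.
        specialize (d0 z hz); specialize (d1 z hz); specialize (Hs z hz).
        assert (Dm : is_derive m z
          (cosh (a * z) * shear_op a z (e0 z) (e1 z) (e2 z))).
        { pose proof (cosh_gt_0 (a * z)); pose proof (cosh_sqr (a * z)) as E.
          unfold m, shear_op; auto_derive_hyps; field [E]; lra. }
        rewrite Hs, Rmult_0_r in Dm; exact Dm.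
    - unfold m; rewrite z0, z1; ring. }
  intros x hx.
  (* Reduction of order: (e0 / cosh)' = m / cosh^3 vanishes. *)
  assert (Q : / cosh (a * 0) * e0 0 = / cosh (a * x) * e0 x).
  { apply (zero_derive_interval (fun t => / cosh (a * t) * e0 t) 0 x hx).
    - intros z Hz; apply (continuity_pt_mult (fun t => / cosh (a * t)) e0);
        [ | apply C0; lra ].
      apply ex_derive_continuity_pt; auto_derive; auto.
      apply Rgt_not_eq, cosh_gt_0.
    - intros z Hz; assert (hz : 0 < z) by lra.
      specialize (d0 z hz); specialize (Hm z (Rlt_le _ _ hz)).
      pose proof (cosh_gt_0 (a * z)).
      assert (Dq : is_derive (fun t => / cosh (a * t) * e0 t) z
                     (m z / cosh (a * z) ^ 3)).
      { unfold m; auto_derive;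
          [ repeat split; [ apply Rgt_not_eq; assumption | eexists; eassumption ]
          | rewrite_derive_hyps; field; lra ]. }
      rewrite Hm in Dq; unfold Rdiv in Dq; rewrite Rmult_0_l in Dq; exact Dq. }
  rewrite z0 in Q; pose proof (cosh_gt_0 (a * x)) as hc.
  assert (Q' : / cosh (a * x) * e0 x = 0) by lra.
  apply Rmult_integral in Q' as [Q' | Q']; [ | exact Q' ].
  pose proof (Rinv_0_lt_compat _ hc); lra.
Qed.

Lemma strip_intro (a : R) (X : chart) (O e w : E3) (tau0 t y : R) :
  cartesian_frame a X O e w -> 0 < t < tau0 -> strip a X tau0 (Phi X t y).
Proof.
  intros HX Ht; split; [ apply (frame_hyp _ _ _ _ _ HX) | ].
  rewrite (frame_tau _ _ _ _ _ HX); exact Ht.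
Qed.

Lemma exterior_intro (a : R) (X : chart) (O e w : E3) (t y : R) :
  cartesian_frame a X O e w -> 0 < t -> exterior_region a X (Phi X t y).
Proof.
  intros HX Ht; split; [ apply (frame_hyp _ _ _ _ _ HX) | ].
  intros [_ H]; rewrite (frame_tau _ _ _ _ _ HX) in H; lra.
Qed.

(** Once the constant value of [shear] is identified from the second derivative at 0, the difference
    to the explicit profile solves the homogeneous linear equation with zero Cauchy data. *)
Lemma laminar_profile_unique (a : R) (ha : 0 < a) (X : chart) (O e w : E3)
  (nu alpha1 alpha2 : R) (hnu : 0 < nu) (Z : R -> R) :
  cartesian_frame a X O e w ->
  smooth_with_jet Z 0 alpha1 (- alpha2) ->
  solves_NS X nu (exterior_region a X) (parallel_flow a X Z) ->
  forall x, 0 <= x -> Z x = laminar_profile a alpha1 alpha2 x.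
Proof.
  intros HX (D & (HZ & HD) & j0 & j1 & j2) HNS.
  set (d := fun k x => D k (Rabs x)).
  assert (Dd : forall k x, 0 < x -> is_derive (d k) x (d (S k) x)).
  { intros k x hx; apply D_in_halfline_derive; [ exact hx | ].
    apply HD; lra. }
  assert (Cd : forall k, continuity_pt (d k) 0).
  { intro k; apply (D_in_halfline_continuity _ (D (S k))), HD; lra. }
  assert (Ed : forall k, d k 0 = D k 0)
    by (intro; unfold d; rewrite Rabs_R0; reflexivity).
  assert (Pos : forall x, 0 < x -> locally x (fun y => 0 < y))
    by (intros x hx; apply open_gt, hx).
  assert (Sh : forall t, 0 < t ->
    shear a Z t = shear_op a t (d 0%nat t) (d 1%nat t) (d 2%nat t)).
  { intros t ht.
    assert (EZ : forall y, 0 < y -> d 0%nat y = Z y).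
    { intros y hy; unfold d; rewrite Rabs_pos_eq by lra; apply HZ; lra. }
    rewrite EZ by exact ht; apply shear_eq; [ | apply Dd, ht ].
    generalize (Pos t ht); apply filter_imp; intros y hy.
    apply is_derive_ext_loc with (d 0%nat); [ | apply Dd, hy ].
    generalize (Pos y hy); apply filter_imp, EZ. }
  assert (Const : forall t, 0 < t -> shear a Z t = shear a Z 1).
  { intros t ht; destruct (Rle_dec t 1); [ | symmetry ];
      apply (solves_NS_shear_constant a ha X O e w nu hnu
               (exterior_region a X)); auto; try lra;
      intros u y Hu; apply (exterior_intro a X O e w _ _ HX); lra. }
  (* The constant is computed as the limit at 0 from the right, where [shear_op] on the prescribed
     jet reduces to the second derivative. [shear a Z 0] itself would depend on the arbitrary values
     of Z at negative arguments. *)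
  assert (Val : shear a Z 1 = - alpha2).
  { rewrite <- (continuity_pt_right_value
      (fun t => shear_op a t (d 0%nat t) (d 1%nat t) (d 2%nat t))
      1 (shear a Z 1) Rlt_0_1).
    - rewrite !Ed, j0, j1, j2; unfold shear_op.
      rewrite Rmult_0_r, sinh_0, cosh_0; ring.
    - apply continuity_shear_op; apply Cd.
    - intros x Hx; rewrite <- Sh by apply Hx; apply Const, Hx. }
  intros x hx; apply Rminus_diag_uniq.
  replace (Z x) with (d 0%nat x)
    by (unfold d; rewrite Rabs_pos_eq by exact hx; apply HZ, hx).
  assert (K0 := fun t => is_derive_laminar_profile a alpha1 alpha2 t ha).
  assert (K1 := fun t => is_derive_laminar_profile' a alpha1 alpha2 t ha).
  apply (shear_op_unique a
    (fun t => d 0%nat t - laminar_profile a alpha1 alpha2 t)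
    (fun t => d 1%nat t - laminar_profile' a alpha1 alpha2 t)
    (fun t => d 2%nat t - laminar_profile'' a alpha1 alpha2 t)); auto.
  - apply (continuity_pt_minus (d 0%nat)); [ apply Cd | ].
    eapply is_derive_continuity_pt, K0.
  - apply (continuity_pt_minus (d 1%nat)); [ apply Cd | ].
    eapply is_derive_continuity_pt, K1.
  - intros t ht; apply (is_derive_minus (d 0%nat)); [ apply Dd, ht | apply K0 ].
  - intros t ht; apply (is_derive_minus (d 1%nat)); [ apply Dd, ht | apply K1 ].
  - intros t ht.
    transitivity (shear_op a t (d 0%nat t) (d 1%nat t) (d 2%nat t)
      - shear_op a t (laminar_profile a alpha1 alpha2 t)
          (laminar_profile' a alpha1 alpha2 t)
          (laminar_profile'' a alpha1 alpha2 t)).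
    + unfold shear_op; ring.
    + rewrite <- Sh, Const, Val, shear_laminar_profile by assumption; ring.
  - rewrite Ed, j0; unfold laminar_profile.
    rewrite Rmult_0_r, sinh_0, cosh_0, atan_0; field; lra.
  - rewrite Ed, j1; unfold laminar_profile'.
    rewrite Rmult_0_r, sinh_0, cosh_0, atan_0; field; lra.
Qed.

Theorem theorem1p10
  (a nu : R) (ha : 0 < a) (hnu : 0 < nu)
  (O : E3) (c : R -> E3) (w : E3) (gam V : R -> E3) (X : chart)
  (hX : cartesian_coordinates a O c w gam V X) :
  (forall alpha1 alpha2 : R, 0 < alpha1 -> 0 < alpha2 ->
     forall tau0 : R, 0 < tau0 ->
       ~ solves_NS X nu (strip a X tau0)
           (parallel_flow a X
              (fun tau => alpha1 * tau - alpha2 / 2 * tau ^ 2))) /\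
  (forall alpha1 alpha2 : R, 0 < alpha1 -> 0 < alpha2 ->
     exists Y : R -> R,
       (smooth_with_jet Y 0 alpha1 (- alpha2) /\
        solves_NS X nu (exterior_region a X) (parallel_flow a X Y)) /\
       (forall Z : R -> R,
          smooth_with_jet Z 0 alpha1 (- alpha2) ->
          solves_NS X nu (exterior_region a X) (parallel_flow a X Z) ->
          forall x, 0 <= x -> Z x = Y x) /\
       real_analytic_on_halfline Y).
Proof.
  pose proof (cartesian_coordinates_frame a ha O c w gam V X hX) as HX.
  split.
  - intros alpha1 alpha2 _ h2 tau0 h0 HNS.
    set (h := fun tau => alpha1 * tau - alpha2 / 2 * tau ^ 2) in HNS.
    (* The midpoint of the strip is the reference point for the constant, since 0 lies outside the
       open strip. *)
    apply (quadratic_shear_not_constant a alpha1 alpha2 tau0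
             (shear a h (tau0 / 2)) ha h2 h0).
    fold h; intros t Ht; destruct (Rle_dec t (tau0 / 2)); [ | symmetry ];
      apply (solves_NS_shear_constant a ha X O _ w nu hnu _ h _ _ HX HNS);
      try lra; intros u y Hu; apply (strip_intro a X O _ w _ _ _ HX); lra.
  - intros alpha1 alpha2 _ _; exists (laminar_profile a alpha1 alpha2).
    split; [ split | split ].
    + apply laminar_profile_jet, ha.
    + apply (solves_NS_of_shear_constant a ha X O (velocity c 0) w nu _ _
               (- alpha2) HX).
      * apply analytic_at_laminar_profile.
      * intros p _.
        rewrite (shear_smooth a _ (laminar_profile' a alpha1 alpha2)
                   (laminar_profile'' a alpha1 alpha2));
          auto using shear_laminar_profile, is_derive_laminar_profile,
            is_derive_laminar_profile'.
    + intros Z; apply (laminar_profile_unique a ha X O (velocity c 0) w nu);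
        assumption.
    + apply analytic_on_halfline, analytic_at_laminar_profile.
Qed.
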